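(* Let $N\ge 1$ and let $J:\mathbb{R}^N\to[0,\infty)$ be measurable, radially symmetric, with $\int_{\mathbb{R}^N}J(y)\,dy=1$ and $H(p)=\int_{\mathbb{R}^N}(e^{p\cdot y}-1)J(y)\,dy<+\infty$ for every $p\in\mathbb{R}^N$. Let $u_0:\mathbb{R}^N\to[0,\infty)$ be continuous and bounded, let $u$ be the bounded strong solution of the non-local equation in $\mathbb{R}^N$ with initial datum $u_0$, and for $R>0$ let $u_R$ be the solution of the non-local Dirichlet problem in $B_R$ with initial datum $u_0$ (both defined in the context). Define the rate function $$I_\infty(x,t)=t\,L^*\Big(\frac{\operatorname{dist}(x,\partial B_1)}{t}\Big),\qquad |x|\le 1,\ t>0 .$$ Then for any fixed $x\in\mathbb{R}^N$ and $t>0$, $$|u-u_R|(x,t)\le e^{-R\,I_\infty(x/R,\,t/R)+o(1)R}\qquad\text{as } R\to\infty,$$ that is, there is a function $\varepsilon(R)$ (depending on $x,t$) with $\varepsilon(R)\to0$ as $R\to\infty$ such that $|u(x,t)-u_R(x,t)|\le \exp(-R I_\infty(x/R,t/R)+\varepsilon(R)R)$ for all sufficiently large $R$. Moreover, for any $\theta\in(0,1)$ and $0<t_1<t_2<+\infty$ the estimate is uniform in the set $\{|x/R|\le\theta,\ t/R\in(t_1,t_2)\}$: there is a function $\varepsilon(R)\to 0$ as $R\to\infty$ (depending only on $\theta,t_1,t_2$ and the data $J,u_0$) such that, for all sufficiently large $R$, $|u(x,t)-u_R(x,t)|\le \exp(-R I_\infty(x/R,t/R)+\varepsilon(R)R)$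 for all $(x,t)$ with $|x|\le\theta R$ and $t/R\in(t_1,t_2)$.
   Context: $B_R=\{x\in\mathbb{R}^N:|x|\le R\}$. A strong solution of the equation in $\mathbb{R}^N$ with initial datum $u_0$ is a function $u$, continuous on $\mathbb{R}^N\times[0,\infty)$, with $u_t$ continuous on $\mathbb{R}^N\times(0,\infty)$, satisfying pointwise $\partial_t u(x,t)=\int_{\mathbb{R}^N}J(x-y)u(y,t)\,dy-u(x,t)$ in $\mathbb{R}^N\times(0,\infty)$ and $u(x,0)=u_0(x)$. Here $u$ is the unique bounded strong solution. The solution $u_R$ of the non-local Dirichlet problem is the bounded function, continuous on $B_R\times[0,\infty)$, with $\partial_t u_R(x,t)=\int_{B_R}J(x-y)u_R(y,t)\,dy-u_R(x,t)$ in $B_R\times(0,\infty)$, $u_R(x,0)=u_0(x)$ in $B_R$, and $u_R=0$ on $(\mathbb{R}^N\setminus B_R)\times[0,\infty)$. The Lagrangian is the Legendre–Fenchel transform $L(q)=\sup_{p\in\mathbb{R}^N}\{p\cdot q-H(p)\}$, $q\in\mathbb{R}^N$. It is radially symmetric, and $L^*:[0,\infty)\to\mathbb{R}$ denotes its radial profile: $L^*(|q|)=L(q)$. *)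

(* Defs.v *)
From HB Require Import structures.
From mathcomp Require Import all_boot all_order all_algebra.
From mathcomp Require Import all_classical all_reals all_analysis.
From mathcomp Require Import measurable_realfun.
Import Order.TTheory GRing.Theory Num.Theory numFieldNormedType.Exports.

Set Implicit Arguments.
Unset Strict Implicit.
Unset Printing Implicit Defensive.

Local Open Scope classical_set_scope.
Local Open Scope ring_scope.

Fact measure_rV_display : measure_display.
Proof. exact: default_measure_display. Qed.

(* 'rV[R]_n carries the sigma-algebra generated by the coordinates, which is
   the Borel sigma-algebra of R^n. *)
Section measurable_rV.
Context {R : realType}.
Variable n : nat.

Let coord (i : 'I_n) (x : 'rV[R]_n) : R := x ord0 i.

Let rV_set0 : g_sigma_preimage coord set0.
Proof. exact: sigma_algebra0. Qed.

Let rV_setC A : g_sigma_preimage coord A -> g_sigma_preimage coord (~` A).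
Proof. exact: sigma_algebraC. Qed.

Let rV_bigcup (F : _^nat) : (forall i, g_sigma_preimage coord (F i)) ->
  g_sigma_preimage coord (\bigcup_i (F i)).
Proof. exact: sigma_algebra_bigcup. Qed.

HB.instance Definition _ := @isMeasurable.Build measure_rV_display
  'rV[R]_n (g_sigma_preimage coord) rV_set0 rV_setC rV_bigcup.

End measurable_rV.

Section rV_measurability.
Context {R : realType}.

Lemma measurable_coord n (i : 'I_n) :
  measurable_fun [set: 'rV[R]_n] (fun x => x ord0 i).
Proof.
move=> _ Y mY; rewrite setTI; apply: sub_sigma_algebra => /=.
rewrite -bigcup_seq/=; exists i => /=; first by rewrite mem_index_enum.
by exists Y => //; rewrite setTI.
Qed.

Lemma measurable_fun_rV d (T : measurableType d) n (f : T -> 'rV[R]_n) :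
  (forall i, measurable_fun [set: T] (fun t => f t ord0 i)) ->
  measurable_fun [set: T] f.
Proof.
move=> mf _ A; rewrite setTI => mA.
have : g_sigma_preimage (fun (i : 'I_n) (t : T) => f t ord0 i) (f @^-1` A).
  rewrite (_ : (fun _ _ => _) = fun i =>
    (fun x : 'rV[R]_n => x ord0 i) \o f)//.
  by rewrite g_sigma_preimage_comp; exists A => //; rewrite setTI.
apply: smallest_sub; first exact: sigma_algebra_measurable.
rewrite -bigcup_seq; apply: bigcup_sub => i _ _ [B mB <-].
exact: mf.
Qed.

Definition rV_cons n (p : measurableTypeR R * 'rV[R]_n) : 'rV[R]_n.+1 :=
  row_mx (p.1 : R)%:M p.2 : 'rV[R]_(1 + n).

Lemma rV_cons0 n p : @rV_cons n p ord0 ord0 = p.1.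
Proof.
rewrite /rV_cons (_ : ord0 = lshift n ord0 :> 'I_(1 + n)); last exact: val_inj.
by rewrite [LHS]row_mxEl mxE eqxx mulr1n.
Qed.

Lemma rV_consS n p i : @rV_cons n p ord0 (lift ord0 i) = p.2 ord0 i.
Proof.
rewrite /rV_cons (_ : lift ord0 i = rshift 1 i); last exact: val_inj.
by rewrite [LHS]row_mxEr.
Qed.

Lemma measurable_rV_cons n : measurable_fun setT (@rV_cons n).
Proof.
apply: measurable_fun_rV => i; case: (unliftP ord0 i) => [j ->|->].
  under eq_fun do rewrite rV_consS.
  exact: (measurableT_comp (measurable_coord j)).
under eq_fun do rewrite rV_cons0.
exact: measurable_fst.
Qed.

Definition rV_uncons n (x : 'rV[R]_n.+1) : measurableTypeR R * 'rV[R]_n :=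
  (x ord0 ord0, \row_i x ord0 (lift ord0 i)).

Lemma rV_consK n : cancel (@rV_cons n) (@rV_uncons n).
Proof.
move=> [x y]; rewrite /rV_uncons rV_cons0; congr pair.
by apply/rowP => i; rewrite mxE rV_consS.
Qed.

Lemma measurable_rV_uncons n : measurable_fun setT (@rV_uncons n).
Proof.
apply/measurable_fun_pairP; split => /=; first exact: measurable_coord.
apply: measurable_fun_rV => i; rewrite /comp/=; under eq_fun do rewrite mxE.
exact: measurable_coord.
Qed.

End rV_measurability.

Section lebesgue_rV.
Context {R : realType}.
Local Open Scope ereal_scope.

Section step.
Variables (n : nat) (mu : {sigma_finite_measure set 'rV[R]_n -> \bar R}).

Definition lebesgue_rV_step : set 'rV[R]_n.+1 -> \bar R :=
  pushforward (lebesgue_measure \x mu) (@rV_cons R n).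

Let step0 : lebesgue_rV_step set0 = 0.
Proof. by rewrite /lebesgue_rV_step /pushforward preimage_set0 measure0. Qed.

Let step_ge0 A : 0 <= lebesgue_rV_step A.
Proof. by rewrite /lebesgue_rV_step /pushforward measure_ge0. Qed.

Let step_sigma_additive : semi_sigma_additive lebesgue_rV_step.
Proof.
move=> F mF tF mUF; rewrite /lebesgue_rV_step /pushforward preimage_bigcup.
have mpre A : measurable A -> measurable (@rV_cons R n @^-1` A).
  by move=> mA; rewrite -[X in measurable X]setTI; exact: measurable_rV_cons.
apply: measure_semi_sigma_additive => //.
- by move=> k; exact: mpre.
- apply/trivIsetP => i j _ _ ij; rewrite -preimage_setI.
  by move/trivIsetP : tF => /(_ _ _ _ _ ij) ->//; rewrite preimage_set0.
- by rewrite -preimage_bigcup; exact: mpre.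
Qed.

HB.instance Definition _ := isMeasure.Build _ _ _
  lebesgue_rV_step step0 step_ge0 step_sigma_additive.

Let step_sigma_finite : sigma_finite setT lebesgue_rV_step.
Proof.
have /sigma_finiteP[F [TF ndF Foo]] := sigma_finiteT (@lebesgue_measure R).
have /sigma_finiteP[G [TG ndG Goo]] := sigma_finiteT mu.
exists (fun k => @rV_uncons R n @^-1` (F k `*` G k)).
  rewrite -preimage_bigcup -[LHS](preimage_setT (@rV_uncons R n)).
  congr (_ @^-1` _); apply/esym/seteqP; split => // -[x y] _.
  have [i _ Fx] : (\bigcup_i F i) x by rewrite -TF.
  have [j _ Gy] : (\bigcup_i G i) y by rewrite -TG.
  exists (maxn i j) => //; split.
    by move: x Fx; exact/subsetPset/ndF/leq_maxl.
  by move: y Gy; exact/subsetPset/ndG/leq_maxr.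
move=> k; have [mF Fk] := Foo k; have [mG Gk] := Goo k; split.
  rewrite -[X in measurable X]setTI; apply: measurable_rV_uncons => //.
  exact: measurableX.
rewrite /lebesgue_rV_step /pushforward -comp_preimage.
rewrite (_ : _ \o _ = id); last by apply/funext => p; exact: rV_consK.
by rewrite preimage_id product_measure1E// lte_mul_pinfty// ge0_fin_numE.
Qed.

HB.instance Definition _ := Measure_isSigmaFinite.Build _ _ _
  lebesgue_rV_step step_sigma_finite.

Lemma lebesgue_rV_stepE (A : set (measurableTypeR R)) (B : set 'rV[R]_n) :
    measurable A -> measurable B ->
  lebesgue_rV_step [set x | A (x ord0 ord0) /\
    B (\row_i x ord0 (lift ord0 i))] = lebesgue_measure A * mu B.
Proof.
move=> mA mB; rewrite -product_measure1E//; congr ((_ \x _) _).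
apply/funext => p; rewrite /preimage/= rV_cons0.
by rewrite -[in RHS](rV_consK p) /rV_uncons/= rV_cons0.
Qed.

End step.

Let sigma_finite_dirac0 : sigma_finite setT (@dirac _ 'rV[R]_0 0%R R).
Proof.
exists (fun=> setT) => [|_]; first by rewrite bigcup_const.
by split => //; rewrite diracT ltry.
Qed.

(* Lebesgue measure on the Borel sets of R^n: R^0 is a point of mass 1, and
   R^n.+1 = R * R^n carries the product measure. *)
Definition lebesgue_rV0 : set 'rV[R]_0 -> \bar R := \d_(0%R : 'rV[R]_0).
HB.instance Definition _ := Measure.on lebesgue_rV0.
HB.instance Definition _ := Measure_isSigmaFinite.Build _ _ _
  lebesgue_rV0 sigma_finite_dirac0.

Fixpoint lebesgue_rV n : {sigma_finite_measure set 'rV[R]_n -> \bar R} :=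
  match n with
  | 0 => lebesgue_rV0
  | m.+1 => lebesgue_rV_step (lebesgue_rV m)
  end.

Lemma lebesgue_rV_box n (A : 'I_n -> set (measurableTypeR R)) :
    (forall i, measurable (A i)) ->
  lebesgue_rV n [set x | forall i, A i (x ord0 i)] =
  \prod_(i < n) lebesgue_measure (A i).
Proof.
elim: n A => [|n IH] A mA.
  rewrite big_ord0 (_ : [set _ | _] = setT); first exact: diracT.
  by apply/seteqP; split => // x _ [].
have mB : measurable [set x : 'rV[R]_n | forall i, A (lift ord0 i) (x ord0 i)].
  rewrite [X in measurable X](_ : _ = \bigcap_(i in [set: 'I_n])
    ((fun x : 'rV[R]_n => x ord0 i) @^-1` A (lift ord0 i))).
    apply: fin_bigcap_measurable => // i _.
    rewrite -[X in measurable X]setTI.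
    exact: (@measurable_coord R n i measurableT _ (mA (lift ord0 i))).
  by apply/seteqP; split => x /= h i; [move=> _|]; exact: h.
rewrite big_ord_recl -IH// -lebesgue_rV_stepE//.
congr (lebesgue_rV_step _ _); apply/seteqP; split => x /=.
  by move=> h; split => [|i]; [exact: h|rewrite mxE; exact: h].
move=> [h0 h] i; case: (unliftP ord0 i) => [j ->|->//].
by have := h j; rewrite mxE.
Qed.

End lebesgue_rV.

Section nonlocal.
Context {R : realType} {N : nat}.
Implicit Types (x y p q : 'rV[R]_N) (t r : R) (A : set 'rV[R]_N).

Definition dot x y : R := \sum_(i < N) x ord0 i * y ord0 i.

(* The norm `|x| of 'rV[R]_N is the max norm; the Euclidean one defines the same
   topology. *)
Definition enorm x : R := Num.sqrt (dot x x).

Definition eball r : set 'rV[R]_N := [set x | enorm x <= r].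

Definition boundary A : set 'rV[R]_N := closure A `\` interior A.

Definition edist x A : R := inf [set enorm (x - z) | z in A].

Definition radially_symmetric (f : 'rV[R]_N -> R) : Prop :=
  forall x y, enorm x = enorm y -> f x = f y.

(* Measurability for the Lebesgue sigma-algebra, i.e. for the completion of the
   Borel one. The library's integral is a supremum over Borel simple functions;
   on functions that are measurable in this sense it is the Lebesgue integral. *)
Definition lebesgue_measurable_fun (f : 'rV[R]_N -> R) : Prop :=
  forall B : set R, measurable B ->
    completed_algebra_gen (lebesgue_rV N) (f @^-1` B).

Section kernel.
Variable J : 'rV[R]_N -> R.

Definition hamiltonian p : \bar R :=
  (\int[lebesgue_rV N]_y ((expR (dot p y) - 1) * J y)%:E)%E.

Definition lagrangian q : \bar R :=
  ereal_sup [set ((dot p q)%:E - hamiltonian p)%E | p in [set: 'rV[R]_N]].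

(* The radial profile of the Lagrangian: the real number s such that L(q) = s
   for all q with |q| = r. That such an s exists (L is finite and radial) is a
   consequence of the hypotheses on J. *)
Definition Lstar r : R :=
  xget 0 [set s : R | forall q, enorm q = r -> lagrangian q = s%:E].

Definition rate x t : R := t * Lstar (edist x (boundary (eball 1)) / t).

Definition bounded_strong_solution (u0 : 'rV[R]_N -> R)
    (u : 'rV[R]_N -> R -> R) : Prop :=
  [/\ exists M, forall x t, 0 <= t -> `|u x t| <= M,
      {within [set z : 'rV[R]_N * R | 0 <= z.2],
        continuous (fun z => u z.1 z.2)},
      forall x t, 0 < t -> derivable (u x) t 1,
      {within [set z : 'rV[R]_N * R | 0 < z.2],
        continuous (fun z => derive1 (u z.1) z.2)} &
      (forall x t, 0 < t -> derive1 (u x) t =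
        \int[lebesgue_rV N]_y (J (x - y) * u y t) - u x t) /\
      (forall x, u x 0 = u0 x)].

Definition dirichlet_solution (u0 : 'rV[R]_N -> R) (r : R)
    (v : 'rV[R]_N -> R -> R) : Prop :=
  [/\ exists M, forall x t, 0 <= t -> `|v x t| <= M,
      {within [set z : 'rV[R]_N * R | eball r z.1 /\ 0 <= z.2],
        continuous (fun z => v z.1 z.2)},
      forall x t, eball r x -> 0 < t -> derivable (v x) t 1 /\
        derive1 (v x) t =
          \int[lebesgue_rV N]_(y in eball r) (J (x - y) * v y t) - v x t,
      forall x, eball r x -> v x 0 = u0 x &
      forall x t, ~ eball r x -> 0 <= t -> v x t = 0].

End kernel.
End nonlocal.

(* Main.v *)
Require Import Defs.
From mathcomp Require Import all_boot all_order all_algebra.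
From mathcomp Require Import all_classical all_reals all_analysis.
From mathcomp Require Import measurable_realfun.
From mathcomp Require Import ring lra.
Import Order.TTheory GRing.Theory Num.Theory numFieldNormedType.Exports.

Set Implicit Arguments.
Unset Strict Implicit.
Unset Printing Implicit Defensive.

Local Open Scope classical_set_scope.
Local Open Scope ring_scope.

(** Outside [B_R] one has [u_R = 0] and [|u| <= M], so [|u - u_R|] is at most
    [M] times the probability that the jump process with jump law [J], started
    at [x], leaves [B_R] before time [t].  The proof is the exponential
    (Chernoff) bound for that probability, carried out on the equation.

    Since the integral of [J (x - y) * expR (dot p y)] in [y] is
    [(1 + H p) * expR (dot p x)], each function
    [expR (dot p y - b + H p * s)] of [(y, s)] solves the equation in the whole
    space, and so does a finite sum of them, called a barrier below.  If a
    barrier is at least 1 outside [B_R], then [M] times it dominates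
    [|u - u_R|] in [B_R] by a maximum principle: at a point where the
    difference is maximal and nonnegative the averaging term cannot exceed the
    value there ([nonlocal_max_principle], [dirichlet_error]).

    It remains to choose momenta for which the barrier is small at [(x, t)].
    Let [l = dist (x, boundary B_R)], [r = l / t] and [s = Lstar r].  For a unit
    vector [w], the definition of the Lagrangian gives a momentum [p] with
    [dot p w >= 0] and [r * dot p w - H p >= s - 1 / t].  For every [y] outside
    [B_R] lying in the direction [w] from [x] this yields
    [dot p (y - x) - t * H p >= t * s - 1], so that direction contributes only
    [expR (- t * s + 1)] at [(x, t)] ([Lstar_momentum]).  Finitely many
    directions are enough: cut the sphere into [(2 k + 1) ^ N] cells of side
    [1 / k] and use one momentum per cell.  The error is [l * N * |p| / k],
    and [|p|] is under control because [H] grows at least quadratically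
    ([mgf_quadratic], [momentum_bound], [exit_cover]).

    With [k] of order [R ^ 2] the error in the exponent stays bounded, uniformly
    for [t] bounded away from 0, while the number of cells is polynomial in [R].
    Both are absorbed, together with [M], by [expR (Num.sqrt R)], so that
    [eps R = R ^ (- 1 / 2)] serves in both parts ([dirichlet_error_rate]).

    The only symmetries of Lebesgue measure used are the reflections
    [y_i -> a_i - y_i] of some of the coordinates.  At the radius [r] at hand
    the number [Lstar r] is by definition either the common value of the
    Lagrangian on the sphere of radius [r], or 0, in which case the momentum 0
    serves every direction; so no comparison between different directions has
    to be made.

    The kernel [J] is measurable only for the completed sigma-algebra; it is
    replaced by a Borel function equal to it off a null set ([borel_kernel_of]),
    which changes none of the integrals. *)

(** * Borel sets and integrals on R^n *)

Section Borel.
Import HBNNSimple.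
Context {R : realType}.

(** Neither function has to be measurable: a simple function below [f], cut off
    on [Z], has the same integral and lies below [g]. *)
Lemma integral_eq_off_null d (T : measurableType d)
    (mu : {measure set T -> \bar R}) (Z : set T) (f g : T -> \bar R) :
  measurable Z -> mu Z = 0%E -> (forall x, ~ Z x -> f x = g x) ->
  (\int[mu]_x f x = \int[mu]_x g x)%E.
Proof.
move=> mZ Z0.
have le_nneg (a b : T -> \bar R) : (forall x, 0 <= a x)%E ->
    (forall x, 0 <= b x)%E -> (forall x, ~ Z x -> a x = b x) ->
    (\int[mu]_x a x <= \int[mu]_x b x)%E.
  move=> a0 b0 ab; rewrite !ge0_integralTE//=.
  apply: ge_ereal_sup => _ [h /= ha <-].
  pose h' : {nnsfun T >-> R} := proj_nnsfun h (measurableC mZ).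
  apply: (@le_trans _ _ (sintegral mu h')); last first.
    apply: ereal_sup_ubound; exists h' => // x /=.
    rewrite mindicE.
    case: (boolP (x \in ~` Z)) => [/set_mem nZx|_].
      by rewrite mulr1 -ab.
    by rewrite mulr0.
  rewrite -!integralT_nnsfun.
  rewrite (@ae_eq_integral _ _ _ mu setT (EFin \o h') (EFin \o h))//.
  - exact/measurable_EFinP.
  - exact/measurable_EFinP.
  - exists Z; split => // x /= /not_implyP[_]; apply: contra_notP => nZx /=.
    by rewrite mindicE mem_set// mulr1.
move=> fg; rewrite integralE [RHS]integralE; congr (_ - _)%E.
  by apply/eqP; rewrite eq_le !le_nneg// => x nZx; rewrite !funeposE ?fg.
by apply/eqP; rewrite eq_le !le_nneg// => x nZx; rewrite !funenegE ?fg.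
Qed.

Variable n : nat.
Implicit Types x y : 'rV[R]_n.

Lemma measurable_forall_coord (A : 'I_n -> set (measurableTypeR R)) :
  (forall i, measurable (A i)) ->
  measurable [set x : 'rV[R]_n | forall i, A i (x ord0 i)].
Proof.
move=> mA; rewrite [X in measurable X](_ : _ = \bigcap_(i in [set: 'I_n])
    ((fun x : 'rV[R]_n => x ord0 i) @^-1` A i)).
  apply: fin_bigcap_measurable => // i _; rewrite -[X in measurable X]setTI.
  exact: (@measurable_coord R n i measurableT _ (mA i)).
by apply/seteqP; split => x /= h i; [move=> _|]; exact: h.
Qed.

Lemma ball_rVE x (e : R) : 0 < e ->
  ball x e = [set y | forall i, ball (x ord0 i) e (y ord0 i)].
Proof.
move=> e0; apply/seteqP; split => y /=; first by move=> [_ h] i; exact: h.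
by move=> h; split => // i j; rewrite (ord1 i); exact: h.
Qed.

(** The balls of the sup norm are boxes, and an open set is the union of the
    countably many of them with rational centre and radius [1 / k.+1] that it
    contains. *)
Lemma open_rV_measurable (U : set 'rV[R]_n) : open U -> measurable U.
Proof.
move=> oU.
pose c (q : 'rV[rat]_n) : 'rV[R]_n := \row_i ratr (q ord0 i).
pose I := [set qk : 'rV[rat]_n * nat | ball (c qk.1) qk.2.+1%:R^-1 `<=` U].
have -> : U = \bigcup_(qk in I) ball (c qk.1) qk.2.+1%:R^-1.
  apply/seteqP; split => [x Ux|x [qk Iqk]]; last exact: Iqk.
  have /nbhs_ballP[e /= e0 xeU] : nbhs x U by exact: open_nbhs_nbhs.
  have [k ke] : exists k, k.+1%:R^-1 < e / 2.
    have [k hk] := @ltr_add_invr R 0 (e / 2) (divr_gt0 e0 (ltr0Sn _ _)).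
    by exists k; rewrite add0r in hk.
  have k0 : (0 : R) < k.+1%:R^-1 by rewrite invr_gt0.
  have rat_near i : exists q : rat, ball (x ord0 i) k.+1%:R^-1 (ratr q : R).
    have /rat_in_itvoo[q] : x ord0 i - k.+1%:R^-1 < x ord0 i + k.+1%:R^-1.
      by rewrite ltrBlDr -addrA ltrDl addr_gt0.
    rewrite in_itv/= => hq; exists q.
    by rewrite /ball/= ltr_distlC.
  have [q qx] := choice rat_near.
  have cx i : c (\row_i q i) ord0 i = ratr (q i) by rewrite /c !mxE.
  exists (\row_i q i, k); last first.
    by rewrite /= ball_rVE// => i; rewrite cx; exact/ball_sym/qx.
  move=> y /=; rewrite ball_rVE// => hy; apply: xeU.
  rewrite ball_rVE// => i; rewrite (splitr e).
  have := ball_triangle (qx i); move/(_ (y ord0 i) k.+1%:R^-1).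
  rewrite -cx => /(_ (hy i)); apply: le_ball.
  by rewrite lerD// ltW.
rewrite bigcup_mkcond; apply: countable_bigcupT_measurable.
  exact: countableP.
move=> -[q k].
case: ifP => //= _; rewrite ball_rVE ?invr_gt0//.
apply: (@measurable_forall_coord (fun i => ball (c q ord0 i) k.+1%:R^-1)).
by move=> i; apply: open_measurable; apply: ball_open; rewrite invr_gt0.
Qed.

Lemma within_continuous_measurable (D : set 'rV[R]_n) (f : 'rV[R]_n -> R) :
  measurable D -> {within D, continuous f} -> measurable_fun D f.
Proof.
move=> mD /continuousP cf; apply: (measurability _ (RGenOpens.measurableE R)).
move=> _ [_ [a [b ->] <-]].
have /cf : open (`]a, b[%classic : set R) by exact: interval_open.
move=> /open_subspaceP[V oV VD].
rewrite setIC -[_ `&` D]VD; apply: measurableI => //; exact: open_rV_measurable.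
Qed.

(** Each set [q < J] with [q] rational differs from a Borel set by a subset of a
    Borel null set.  [Z] is the union of these countably many null sets. *)
Lemma borel_version (J : 'rV[R]_n -> R) : (forall y, 0 <= J y) ->
  lebesgue_measurable_fun J ->
  exists Z : set 'rV[R]_n, [/\ measurable Z, lebesgue_rV n Z = 0%E &
    measurable_fun setT (fun y => J y * \1_(~` Z) y)].
Proof.
move=> J0 mJ.
pose q n : R := ratr (odflt 0 (unpickle n)).
have superlevel k : exists AN : set 'rV[R]_n * set 'rV[R]_n,
    [/\ measurable AN.1, measurable AN.2, lebesgue_rV n AN.2 = 0%E &
      forall y, ~ AN.2 y -> (q k < J y) <-> AN.1 y].
  have [A mA [N' [B [mB B0 NB]] AN]] :=
    mJ `]q k, +oo[%classic (measurable_itv _).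
  exists (A, B); split => //= y nBy.
  split=> [qJ|Ay].
    have : (A `|` N') y by rewrite AN /= in_itv/= andbT.
    by case=> // /NB.
  have : (A `|` N') y by left.
  by rewrite AN /= in_itv/= andbT.
have [AB hAB] := choice superlevel.
pose Z := \bigcup_k (AB k).2.
have mZ : measurable Z by apply: bigcup_measurable => k _; have [] := hAB k.
have Z0 : lebesgue_rV n Z = 0%E.
  apply/negligibleP => //; apply: negligible_bigcup => k.
  by apply/negligibleP; have [] := hAB k.
exists Z; split => //.
apply: (measurability _ (RGenOInfty.measurableE R)).
move=> _ [_ [a ->] <-]; rewrite setTI.
rewrite [X in measurable X](_ : _ = \bigcup_(k in [set k | a < q k])
    [set y | q k < J y * \1_(~` Z) y]).
  apply: bigcup_measurable => k _.
  have [q0|q0] := ltP (q k) 0.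
    rewrite [X in measurable X](_ : _ = setT) //.
    apply/seteqP; split => // y _ /=; apply: lt_le_trans q0 _.
    by rewrite mulr_ge0.
  have [mA mB B0 AJ] := hAB k.
  rewrite [X in measurable X](_ : _ = (AB k).1 `&` ~` Z).
    by apply: measurableI => //; exact: measurableC.
  apply/seteqP; split => y /=.
    rewrite indicE; have [/set_mem nZy|] := boolP (y \in ~` Z).
      rewrite mulr1 => qJ; split => //; apply/AJ => //.
      by apply: contra_not nZy => By; exists k.
    by rewrite mulr0 ltNge q0.
  move=> [Ay nZy]; rewrite indicE mem_set// mulr1; apply/AJ => //.
  by apply: contra_not nZy => By; exists k.
apply/seteqP; split => y /=; rewrite in_itv/= andbT.
  move=> /rat_in_itvoo[r]; rewrite in_itv/= => /andP[ar ry].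
  by exists (pickle r); rewrite /= /q pickleK.
by move=> [k /= ak]; exact: lt_trans.
Qed.
End Borel.

(** * Reflections of coordinates preserve Lebesgue measure *)

Section Reflection.
Context {R : realType}.

Lemma lebesgue_measure_reflect (c : R) (A : set (measurableTypeR R)) :
  measurable A ->
  lebesgue_measure ((fun z : R => c - z) @^-1` A) = lebesgue_measure A.
Proof.
have mc : measurable_fun setT
    ((fun y => c - y) : measurableTypeR R -> measurableTypeR R).
  by apply: measurable_funB => //; exact: measurable_cst.
move=> mA; rewrite -[LHS]/(pushforward lebesgue_measure
  ((fun y => c - y) : measurableTypeR R -> measurableTypeR R) A).
apply/esym/lebesgue_measure_unique => //= _ [[a b]] _ <-.
rewrite /pushforward/= (_ : _ @^-1` _ = `[c - b, c - a[%classic); last first.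
  by apply/seteqP; split => y /=; rewrite !in_itv/=; lra.
rewrite !lebesgue_measure_itv/= !lte_fin ltrD2l ltrN2; case: ifP => // _.
by rewrite -!EFinB; congr EFin; ring.
Qed.

Variable n : nat.
Implicit Types (a x y : 'rV[R]_n) (S : {set 'I_n}).

(** One family that contains both the map [y -> a - y] of a convolution, for [S]
    the set of all indices, and the changes of sign of coordinates, for
    [a = 0]. *)
Definition reflect S a y : 'rV[R]_n :=
  \row_i if i \in S then a ord0 i - y ord0 i else y ord0 i.

Lemma measurable_reflect S a : measurable_fun setT (reflect S a).
Proof.
apply: measurable_fun_rV => i.
under eq_fun do rewrite mxE.
case: (i \in S); last exact: measurable_coord.
by apply: measurable_funB => //; exact: measurable_coord.
Qed.

Let boxes := [set B : set 'rV[R]_n |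
  exists2 A : 'I_n -> set (measurableTypeR R), (forall i, measurable (A i)) &
    B = [set x | forall i, A i (x ord0 i)]].

Let measurable_boxes : @measurable _ 'rV[R]_n = <<s boxes >>.
Proof.
apply/seteqP; split; last first.
  apply: smallest_sub; first exact: sigma_algebra_measurable.
  by move=> _ [A mA ->]; exact: measurable_forall_coord.
apply: smallest_sub; first exact: smallest_sigma_algebra.
rewrite -bigcup_seq; apply: bigcup_sub => i _ _ [B mB <-].
apply: sub_sigma_algebra; exists (fun j => if j == i then B else setT).
  by move=> j; case: ifP.
rewrite setTI; apply/seteqP; split => x /=.
  by move=> Bx j; case: ifP => // /eqP ->.
by move/(_ i); rewrite eqxx.
Qed.

(** A measure that is finite on bounded boxes is determined by its values on all
    boxes; there the claim is the one-dimensional one in each factor. *)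
Lemma lebesgue_rV_reflect S a (A : set 'rV[R]_n) : measurable A ->
  lebesgue_rV n (reflect S a @^-1` A) = lebesgue_rV n A.
Proof.
pose cube k :=
  [set x : 'rV[R]_n | forall i, `]- k%:R, k%:R[%classic (x ord0 i)].
rewrite -[LHS]/(pushforward (lebesgue_rV n) (reflect S a) A) => mA; apply/esym.
apply: (measure_unique boxes cube measurable_boxes) => //.
- move=> _ _ [A1 mA1 ->] [B mB ->]; exists (fun i => A1 i `&` B i).
    by move=> i; exact: measurableI.
  apply/seteqP; split => x /=; first by move=> [h1 h2] i; split.
  by move=> h; split => i; have [] := h i.
- move=> k; exists (fun=> `]- k%:R, k%:R[%classic) => //.
- apply/seteqP; split => // x _.
  exists (Num.truncn `|x|).+1 => // i /=; rewrite in_itv/= -ltr_norml.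
  apply: le_lt_trans (truncnS_gt _).
  rewrite [leRHS]/Num.norm/= mx_normrE.
  exact: (le_bigmax _ (fun ij => `|x ij.1 ij.2|) (ord0, i)).
- exact: measurable_reflect.
- move=> ? _ [B mB ->]; apply/esym.
  pose C i := if i \in S then (fun z : R => a ord0 i - z) @^-1` B i else B i.
  rewrite -[LHS]/(lebesgue_rV n [set x | forall i, B i (reflect S a x ord0 i)]).
  rewrite (_ : [set x | forall i, B i (reflect S a x ord0 i)] =
      [set x | forall i, C i (x ord0 i)]); last first.
    by apply/seteqP; split => x /= h i; have := h i; rewrite /C mxE; case: ifP.
  have mC i : measurable (C i : set (measurableTypeR R)).
    rewrite /C; case: ifP => // _; rewrite -[X in measurable X]setTI.
    have mc : measurable_fun setT
        ((fun z => a ord0 i - z) : measurableTypeR R -> measurableTypeR R).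
      by apply: measurable_funB => //; exact: measurable_cst.
    exact: mc.
  transitivity (\prod_(i < n) lebesgue_measure (C i))%E.
    exact: (lebesgue_rV_box mC).
  transitivity (\prod_(i < n) lebesgue_measure (B i))%E; last first.
    exact/esym/(lebesgue_rV_box mB).
  apply: eq_bigr => i _; rewrite /C; case: ifP => // _.
  exact: lebesgue_measure_reflect.
- move=> k; rewrite ltey_eq; apply/orP; left.
  pose I : set (measurableTypeR R) := `]- k%:R, k%:R[%classic.
  rewrite [X in X \is a fin_num](_ : _ =
      (\prod_(i < n) lebesgue_measure I)%E); last first.
    by apply: (@lebesgue_rV_box R n (fun=> I)) => i; exact: measurable_itv.
  apply: (big_ind (fun x : \bar R => x \is a fin_num)) => // [x y|i _].
    exact: fin_numM.
  by rewrite /I lebesgue_measure_itv/=; case: ifP.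
Qed.

Lemma ge0_integral_reflect S a (f : 'rV[R]_n -> \bar R) :
  measurable_fun setT f -> (forall y, 0 <= f y)%E ->
  (\int[lebesgue_rV n]_y f (reflect S a y) = \int[lebesgue_rV n]_y f y)%E.
Proof.
move=> mf f0.
have := @ge0_integral_pushforward _ _ _ _ _ _ (measurable_reflect S a)
  (lebesgue_rV n) setT f measurableT mf (fun y _ => f0 y).
rewrite preimage_setT => <-.
apply: (eq_measure_integral (lebesgue_rV n)).
  exact: measurable_reflect.
by move=> ? A mA _; exact: lebesgue_rV_reflect.
Qed.

End Reflection.

(** * The exponential moments of a kernel *)

(** [expR a + expR (- a) - 2] is the square of
    [expR (a / 2) - expR (- a / 2)], which is at least [a / 2] for [a >= 0]. *)
Lemma expRD_expRN_ge {R : realType} (a : R) :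
  2 + a ^+ 2 / 4 <= expR a + expR (- a).
Proof.
wlog a0 : a / 0 <= a.
  move=> hwlog.
  have [/hwlog//|/ltW a0] := leP 0 a.
  have := hwlog (- a); rewrite opprK sqrrN [expR _ + _]addrC.
  by apply; rewrite oppr_ge0.
have e1 : expR a = expR (a / 2) ^+ 2 by rewrite expr2 -expRD -splitr.
have e2 : expR (- a) = expR (- (a / 2)) ^+ 2.
  by rewrite expr2 -expRD -opprD -splitr.
have e12 : expR (a / 2) * expR (- (a / 2)) = 1 by rewrite -expRD subrr expR0.
have h1 := expR_ge1Dx (a / 2).
have h2 : expR (- (a / 2)) <= 1 by rewrite expR_le1; lra.
rewrite e1 e2; set u := expR _ in e12 h1 h2 *; set v := expR _ in e12 h1 h2 *.
have : (a / 2) ^+ 2 <= (u - v) ^+ 2 by rewrite lerXn2r ?nnegrE; lra.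
by rewrite !expr2; lra.
Qed.

Section Dot.
Context {R : realType} {n : nat}.
Implicit Types p x y : 'rV[R]_n.

Lemma dotDr p x y : dot p (x + y) = dot p x + dot p y.
Proof.
by rewrite /dot -big_split; apply: eq_bigr => i _; rewrite mxE mulrDr.
Qed.

Lemma dotZr p (c : R) x : dot p (c *: x) = c * dot p x.
Proof.
by rewrite /dot mulr_sumr; apply: eq_bigr => i _; rewrite mxE mulrCA.
Qed.

Lemma dotC x y : dot x y = dot y x.
Proof. by apply: eq_bigr => i _; rewrite mulrC. Qed.

Lemma dotNr p x : dot p (- x) = - dot p x.
Proof. by rewrite -scaleN1r dotZr mulN1r. Qed.

Lemma dotBr p x y : dot p (x - y) = dot p x - dot p y.
Proof. by rewrite dotDr dotNr. Qed.

Lemma dot0l x : dot 0 x = 0.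
Proof. by rewrite /dot big1// => i _; rewrite mxE mul0r. Qed.

Lemma measurable_dot p : measurable_fun setT (dot p).
Proof.
apply: measurable_sum => i; apply: measurable_funM; first exact: measurable_cst.
exact: measurable_coord.
Qed.

Lemma reflect_setT x y : reflect [set: 'I_n]%SET x y = x - y.
Proof. by apply/rowP => i; rewrite !mxE inE. Qed.

Lemma lebesgue_rV_hyperplane (j : 'I_n) :
  lebesgue_rV n [set y : 'rV[R]_n | y ord0 j = 0] = 0%E.
Proof.
pose A i : set (measurableTypeR R) := if i == j then [set 0] else setT.
have mA i : measurable (A i) by rewrite /A; case: ifP.
rewrite [X in lebesgue_rV n X](_ : _ =
    [set y : 'rV[R]_n | forall i, A i (y ord0 i)]).
  rewrite (lebesgue_rV_box mA) (bigD1 j)//= /A eqxx.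
  by rewrite lebesgue_measure_set1 mul0e.
apply/seteqP; split => y /=; last by move/(_ j); rewrite /A eqxx.
by move=> y0 i; rewrite /A; case: eqP => // ->.
Qed.

End Dot.

Section BorelKernel.
Context {R : realType} {n : nat}.
Local Notation V := 'rV[R]_n.
Local Notation mu := (lebesgue_rV n).

(** The symmetry is asked for almost everywhere only, because a Borel function
    equal to a radial one almost everywhere need not be radial. *)
Definition borel_kernel (K : V -> R) : Prop :=
  [/\ measurable_fun setT K,
      forall y, 0 <= K y,
      (\int[mu]_y (K y)%:E = 1)%E,
      forall S : {set 'I_n}, exists Z : set V,
        [/\ measurable Z, mu Z = 0%E &
            forall y, ~ Z y -> K (reflect S 0 y) = K y] &
      forall p : V, (\int[mu]_y (expR (dot p y) * K y)%:E < +oo)%E].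

Variable K : V -> R.
Hypothesis hK : borel_kernel K.

Let mK : measurable_fun setT K. Proof. by case: hK. Qed.
Let K0 y : 0 <= K y. Proof. by case: hK. Qed.
Let K1 : (\int[mu]_y (K y)%:E = 1)%E. Proof. by case: hK. Qed.

Lemma ge0_integral_kernel_reflect (S : {set 'I_n}) (g : V -> R) :
  measurable_fun setT g -> (forall y, 0 <= g y) ->
  (\int[mu]_y (g (reflect S 0 y) * K y)%:E = \int[mu]_y (g y * K y)%:E)%E.
Proof.
move=> mg g0; have [_ _ _ /(_ S)[Z [mZ Z0 ZK]] _] := hK.
have <- := @ge0_integral_reflect R n S 0 (fun y => (g y * K y)%:E).
- by apply: (integral_eq_off_null mZ Z0) => y /ZK ->.
- by apply/measurable_EFinP; exact: measurable_funM.
- by move=> y; rewrite lee_fin mulr_ge0.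
Qed.

Lemma ge0_integral_kernel_average (S : {set 'I_n}) (g : V -> R) :
  measurable_fun setT g -> (forall y, 0 <= g y) ->
  (\int[mu]_y (((g y + g (reflect S 0 y)) / 2) * K y)%:E
   = \int[mu]_y (g y * K y)%:E)%E.
Proof.
move=> mg g0.
have mgr : measurable_fun setT (fun y => g (reflect S 0 y)).
  by apply: (measurableT_comp mg); exact: measurable_reflect.
transitivity (\int[mu]_y ((2^-1)%:E * (g y * K y)%:E +
    (2^-1)%:E * (g (reflect S 0 y) * K y)%:E))%E.
  by apply: eq_integral => y _; rewrite -!EFinM -EFinD; congr EFin; field.
have mgK : measurable_fun setT (fun y => (g y * K y)%:E).
  by apply/measurable_EFinP; exact: measurable_funM.
have mgrK : measurable_fun setT (fun y => (g (reflect S 0 y) * K y)%:E).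
  by apply/measurable_EFinP; exact: measurable_funM.
have gK0 y : (0 <= (g y * K y)%:E)%E by rewrite lee_fin mulr_ge0.
have grK0 y : (0 <= (g (reflect S 0 y) * K y)%:E)%E.
  by rewrite lee_fin mulr_ge0.
have h0 : (0 <= (2^-1 : R)%:E)%E by rewrite lee_fin.
rewrite ge0_integralD//=; last 4 first.
- by move=> y _; exact: mule_ge0.
- exact: measurable_funeM.
- by move=> y _; exact: mule_ge0.
- exact: measurable_funeM.
rewrite !ge0_integralZl//=.
rewrite ge0_integral_kernel_reflect// -ge0_muleDl ?lee_fin//.
by rewrite -EFinD (_ : 2^-1 + 2^-1 = 1) ?mul1e//; field.
Qed.

Definition mgf (p : V) : R := fine (\int[mu]_y (expR (dot p y) * K y)%:E)%E.

Lemma mgfE p : (\int[mu]_y (expR (dot p y) * K y)%:E)%E = (mgf p)%:E.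
Proof.
rewrite fineK// ge0_fin_numE; first by case: hK.
by apply: integral_ge0 => y _; rewrite lee_fin mulr_ge0// expR_ge0.
Qed.

Lemma measurable_expR_dot (p : V) :
  measurable_fun setT (fun y => expR (dot p y)).
Proof. by apply: measurableT_comp => //; exact: measurable_dot. Qed.

(** The exponentials are eigenfunctions of the convolution with [K]; the
    symmetry of [K] turns the eigenvalue [mgf (- p)] into [mgf p]. *)
Lemma mgf_convolution (p x : V) :
  (\int[mu]_y (K (x - y) * expR (dot p y))%:E = (expR (dot p x) * mgf p)%:E)%E.
Proof.
pose f z := (expR (dot p (x - z)) * K z)%:E.
have mf : measurable_fun setT f.
  apply/measurable_EFinP/measurable_funM => //; apply: measurableT_comp => //.
  under eq_fun do rewrite dotBr; apply: measurable_funB => //.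
  exact: measurable_dot.
have f0 y : (0 <= f y)%E by rewrite lee_fin mulr_ge0 ?expR_ge0.
have := @ge0_integral_reflect R n [set: 'I_n]%SET x f mf f0.
under eq_integral do rewrite /f reflect_setT subKr mulrC.
move=> ->; rewrite EFinM -mgfE.
rewrite -(ge0_integral_kernel_reflect [set: 'I_n]%SET
  (measurable_expR_dot p) (fun y => expR_ge0 _)).
have mr : measurable_fun setT
    (fun y => (expR (dot p (reflect [set: 'I_n]%SET 0 y)) * K y)%:E).
  apply/measurable_EFinP/measurable_funM => //.
  apply: (measurableT_comp (measurable_expR_dot p)).
  exact: measurable_reflect.
rewrite -ge0_integralZl//; last first.
  by move=> y _; rewrite lee_fin mulr_ge0 ?expR_ge0.
apply: eq_integral => y _; rewrite /f reflect_setT -EFinM mulrA -expRD.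
by rewrite dotBr sub0r dotNr.
Qed.

(** Averaging [expR (dot p y)] over the four images of [y] under a change of all
    signs and a change of the sign of [y_j] gives, with [a = p_j y_j] and
    [b = dot p y - a], one quarter of the sum of [expR] over [b + a], [b - a]
    and their opposites, hence at least [1 + a ^ 2 / 8].  The second moment of
    [y_j] that results is positive since hyperplanes are null sets. *)
Lemma mgf_quadratic (j : 'I_n) : exists2 c : R, 0 < c &
  forall p : V, 1 + c * (p ord0 j) ^+ 2 <= mgf p.
Proof.
pose m := (\int[mu]_y ((y ord0 j) ^+ 2 * K y)%:E)%E.
have mj : measurable_fun setT (fun y : V => (y ord0 j) ^+ 2).
  by apply: measurable_funX; exact: measurable_coord.
have m0 : (0 <= m)%E.
  by apply: integral_ge0 => y _; rewrite lee_fin mulr_ge0// sqr_ge0.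
have lower (p : V) : ((mgf p)%:E >= 1 + ((p ord0 j) ^+ 2 / 8)%:E * m)%E.
  rewrite -mgfE -(ge0_integral_kernel_average [set: 'I_n]%SET
    (measurable_expR_dot p) (fun y => expR_ge0 _)).
  pose g y := (expR (dot p y) + expR (dot p (reflect [set: 'I_n]%SET 0 y))) / 2.
  have mg : measurable_fun setT g.
    apply: measurable_funM => //; apply: measurable_funD.
      exact: measurable_expR_dot.
    apply: (measurableT_comp (measurable_expR_dot p)).
    exact: measurable_reflect.
  have g0 y : 0 <= g y by rewrite divr_ge0// addr_ge0// expR_ge0.
  rewrite -/(g _) -(ge0_integral_kernel_average [set j]%SET mg g0).
  have mjK : measurable_fun setT (fun y : V => ((y ord0 j) ^+ 2 * K y)%:E).
    by apply/measurable_EFinP; exact: measurable_funM.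
  have mEK : measurable_fun setT (fun y => (K y)%:E) by exact/measurable_EFinP.
  have p0 : 0 <= (p ord0 j) ^+ 2 / 8 by rewrite divr_ge0// sqr_ge0.
  have jK0 (y : V) : 0 <= (y ord0 j) ^+ 2 * K y by rewrite mulr_ge0// sqr_ge0.
  rewrite -K1 /m -ge0_integralZl//; last by move=> y _; rewrite lee_fin.
  have jK0' (y : V) :
      (0 <= ((p ord0 j) ^+ 2 / 8)%:E * ((y ord0 j) ^+ 2 * K y)%:E)%E.
    by rewrite -EFinM lee_fin mulr_ge0.
  have EK0 y : (0 <= (K y)%:E)%E by rewrite lee_fin.
  rewrite -ge0_integralD//; last exact: measurable_funeM.
  apply: ge0_le_integral => //.
  - by move=> y _; rewrite adde_ge0.
  - by apply: emeasurable_funD => //; exact: measurable_funeM.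
  - apply/measurable_EFinP/measurable_funM => //; apply: measurable_funM => //.
    apply: measurable_funD => //; apply: (measurableT_comp mg).
    exact: measurable_reflect.
  move=> y _; rewrite -EFinM -EFinD lee_fin.
  rewrite -[X in X + _]mul1r mulrA -mulrDl ler_wpM2r//.
  rewrite /g !reflect_setT !sub0r !dotNr.
  set a := p ord0 j * y ord0 j; set b := dot p y - a.
  have -> : dot p y = b + a by rewrite subrK.
  have -> : dot p (reflect [set j]%SET 0 y) = b - a.
    rewrite /b /dot (bigD1 j)//= !mxE inE eqxx sub0r [in RHS](bigD1 j)//=.
    rewrite mulrN -/a [a + _]addrC addrK addrC; congr (_ - _).
    by apply: eq_bigr => i /negbTE ij; rewrite mxE inE ij.
  have := expRD_expRN_ge (b + a); have := expRD_expRN_ge (b - a).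
  set e1 := expR (b + a); set e2 := expR (- (b + a)).
  set e3 := expR (b - a); set e4 := expR (- (b - a)).
  have : a ^+ 2 = (p ord0 j) ^+ 2 * (y ord0 j) ^+ 2 by rewrite exprMn.
  rewrite [_ / 8 * _]mulrAC => <-.
  have : (b + a) ^+ 2 + (b - a) ^+ 2 = 2 * b ^+ 2 + 2 * a ^+ 2 by ring.
  have := sqr_ge0 b.
  lra.
have mfin : m \is a fin_num.
  rewrite ge0_fin_numE//.
  have := lower (\row_i (i == j)%:R).
  rewrite mxE eqxx expr1n mul1r ltNge leye_eq; apply: contraL => /eqP ->.
  by rewrite gt0_muley ?lte_fin// addey// leNgt ltry.
have m_gt0 : 0 < fine m.
  rewrite lt_def fine_ge0// andbT; apply/eqP => mE.
  have {mE} : m = 0%E by rewrite -(fineK mfin) mE.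
  rewrite /m => mE.
  have mE0 : (\int[mu]_y `|((y ord0 j) ^+ 2 * K y)%:E| = 0)%E.
    rewrite -[RHS]mE; apply: eq_integral => y _.
    by rewrite gee0_abs// lee_fin mulr_ge0// sqr_ge0.
  have mjK : measurable_fun setT (fun y : V => ((y ord0 j) ^+ 2 * K y)%:E).
    by apply/measurable_EFinP; exact: measurable_funM.
  have [N [mN N0 hN]] := (ae_eq_integral_abs mu measurableT mjK).1 mE0.
  pose Y := [set y : V | y ord0 j = 0].
  have mY : measurable Y.
    by rewrite -[Y]setTI; apply: (@measurable_coord R n j measurableT [set 0]).
  have NY0 : mu (N `|` Y) = 0%E.
    by rewrite -[RHS]N0; apply: measureU0 => //; exact: lebesgue_rV_hyperplane.
  have := K1; rewrite (integral_eq_off_null (measurableU _ _ mN mY) NY0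
    (g := cst 0%E)).
    by rewrite [LHS]integral0 => /esym/eqP; rewrite onee_eq0.
  move=> y /not_orP[nNy nYy]; congr EFin.
  have : ((y ord0 j) ^+ 2 * K y)%:E = 0%E by apply: contra_notP nNy => h;
    apply: hN => /(_ I).
  by move=> [/eqP]; rewrite mulf_eq0 sqrf_eq0 => /orP[/eqP//|/eqP].
exists (fine m / 8); first by rewrite divr_gt0.
move=> p; have := lower p; rewrite -(fineK mfin) -EFinM -EFinD lee_fin.
by rewrite /= [_ / 8 * fine m]mulrC mulrA mulrAC.
Qed.

End BorelKernel.

Section BorelVersion.
Context {R : realType} {n : nat}.
Local Notation V := 'rV[R]_n.
Local Notation mu := (lebesgue_rV n).

Lemma enorm_reflect (S : {set 'I_n}) (y : V) : enorm (reflect S 0 y) = enorm y.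
Proof.
congr Num.sqrt; apply: eq_bigr => i _; rewrite !mxE.
by case: ifP => // _; rewrite sub0r mulrNN.
Qed.

Lemma measurable_reflect_preimage (S : {set 'I_n}) (a : V) (A : set V) :
  measurable A -> measurable (reflect S a @^-1` A).
Proof.
by move=> mA; rewrite -[X in measurable X]setTI; exact: measurable_reflect.
Qed.

(** The integrals involving [J] never see the change on a null set, whatever the
    other factor [g] is, by [integral_eq_off_null]. *)
Lemma borel_kernel_of (J : V -> R) :
  (forall y, 0 <= J y) -> lebesgue_measurable_fun J -> radially_symmetric J ->
  (\int[mu]_y (J y)%:E = 1)%E -> (forall p, (hamiltonian J p < +oo)%E) ->
  exists K : V -> R, [/\ borel_kernel K,
    forall p, hamiltonian J p = (mgf K p - 1)%:E &
    forall x (g : V -> R),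
      \int[mu]_y (J (x - y) * g y) = \int[mu]_y (K (x - y) * g y)].
Proof.
move=> J0 mJ rJ J1 HJ.
have [Z [mZ Z0 mK]] := borel_version J0 mJ.
pose K y := J y * \1_(~` Z) y.
have KJ y : ~ Z y -> K y = J y by move=> nZy; rewrite /K indicE mem_set// mulr1.
have K0 y : 0 <= K y by rewrite mulr_ge0.
have mEK : measurable_fun setT (fun y => (K y)%:E) by exact/measurable_EFinP.
have K1 : (\int[mu]_y (K y)%:E = 1)%E.
  by rewrite -J1; apply: (integral_eq_off_null mZ Z0) => y /KJ ->.
have hamE p : hamiltonian J p = (\int[mu]_y ((expR (dot p y) - 1) * K y)%:E)%E.
  by apply/esym/(integral_eq_off_null mZ Z0) => y /KJ ->.
have K_mgf p : (\int[mu]_y (expR (dot p y) * K y)%:E < +oo)%E.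
  pose f y := ((expR (dot p y) - 1) * K y)%:E.
  have mf : measurable_fun setT f.
    apply/measurable_EFinP/measurable_funM => //; apply: measurable_funB => //.
    exact: measurable_expR_dot.
  (* A finite integral of [f] bounds that of its positive part, as its negative
     part is at most [K]. *)
  have fneg : (\int[mu]_y f^\- y <= 1)%E.
    rewrite -K1; apply: ge0_le_integral => //.
      exact: measurable_funeneg.
    move=> y _; rewrite funenegE ge_max.
    apply/andP; split; last by rewrite lee_fin.
    rewrite /f -EFinN lee_fin -mulNr opprB mulrBl mul1r gerBl.
    by rewrite mulr_ge0// expR_ge0.
  have fpos : (\int[mu]_y f^\+ y < +oo)%E.
    have := HJ p; rewrite hamE -/(f _) integralE.
    have fneg_fin : (\int[mu]_y f^\- y)%E \is a fin_num.
      by rewrite ge0_fin_numE ?integral_ge0// (le_lt_trans fneg)// ltry.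
    rewrite !ltNge !leye_eq; apply: contra => /eqP ->.
    by rewrite addye// -(fineK fneg_fin).
  have EK0 y : (0 <= (K y)%:E)%E by rewrite lee_fin.
  have mfp : measurable_fun setT f^\+%E by exact: measurable_funepos.
  have eK0 y : (0 <= (expR (dot p y) * K y)%:E)%E.
    by rewrite lee_fin mulr_ge0// expR_ge0.
  have meK : measurable_fun setT (fun y => (expR (dot p y) * K y)%:E).
    apply/measurable_EFinP/measurable_funM => //; exact: measurable_expR_dot.
  have mfK : measurable_fun setT (fun y => (f^\+ y + (K y)%:E)%E).
    exact: emeasurable_funD.
  have fK0 y : (0 <= f^\+ y + (K y)%:E)%E by rewrite adde_ge0.
  apply: (@le_lt_trans _ _ (\int[mu]_y (f^\+ y + (K y)%:E))%E).
    apply: ge0_le_integral => // y _.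
    apply: (@le_trans _ _ (f y + (K y)%:E)%E).
      by rewrite /f -EFinD lee_fin mulrBl mul1r subrK.
    by rewrite leeD2r// funeposE le_max lexx.
  rewrite ge0_integralD//.
  by rewrite K1 lte_add_pinfty// ltry.
have hK : borel_kernel K.
  split=> // S.
  exists (Z `|` reflect S 0 @^-1` Z); split.
  - by apply: measurableU => //; exact: measurable_reflect_preimage.
  - rewrite -[RHS]Z0; apply: measureU0 => //.
      exact: measurable_reflect_preimage.
    by rewrite -[RHS]Z0; exact: lebesgue_rV_reflect.
  - move=> y /not_orP[nZy nZry]; rewrite !KJ//.
    by apply: rJ; exact: enorm_reflect.
exists K; split => //.
- move=> p; rewrite hamE EFinB -(mgfE hK) -[in RHS]K1 -integralB_EFin//.
  + by apply: eq_integral => y _; rewrite -EFinB mulrBl mul1r.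
  + apply/integrableP; split.
      apply/measurable_EFinP/measurable_funM => //.
      exact: measurable_expR_dot.
    under eq_integral do rewrite gee0_abs ?lee_fin ?mulr_ge0 ?expR_ge0//.
    exact: K_mgf.
  + apply/integrableP; split => //.
    under eq_integral do rewrite gee0_abs ?lee_fin//.
    by rewrite K1 ltry.
- move=> x g; congr fine.
  have mZx := measurable_reflect_preimage [set: 'I_n]%SET x mZ.
  apply: (integral_eq_off_null mZx).
    by rewrite -[RHS]Z0; exact: lebesgue_rV_reflect.
  by move=> y; rewrite /= reflect_setT => /KJ ->.
Qed.

End BorelVersion.

(** * The maximum principle *)

Section MaximumPrinciple.
Context {R : realType}.

Lemma within_continuous_comp (T U : topologicalType) (D : set T) (A : set U)
    (g : T -> U) (f : U -> R) :
  continuous g -> (forall x, D x -> A (g x)) -> {within A, continuous f} ->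
  {within D, continuous (fun x => f (g x))}.
Proof.
move=> /continuousP cg DA /continuousP cf; apply/continuousP => O oO.
have [V oV VA] := (open_subspaceP _ _).1 (cf O oO).
apply/open_subspaceP; exists (g @^-1` V); first exact: cg.
apply/seteqP; split => x [gx Dx]; split => //.
  have : (V `&` A) (g x) by split => //; exact: DA.
  by rewrite VA => -[].
have : (from_subspace A f @^-1` O `&` A) (g x) by split => //; exact: DA.
by rewrite -VA => -[].
Qed.

Lemma within_continuousB (T : topologicalType) (D : set T) (f g : T -> R) :
  {within D, continuous f} -> {within D, continuous g} ->
  {within D, continuous (fun x => f x - g x)}.
Proof. by move=> cf cg x; apply: cvgB; [exact: cf|exact: cg]. Qed.

Lemma derive1_ge_left (f : R -> R) (c a : R) : 0 < c -> derivable f c 1 ->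
  (forall s, 0 <= s <= c -> f s - f c <= a * (s - c)) -> a <= derive1 f c.
Proof.
move=> c0 df fa; rewrite derive1E ['D_1 f c]cvg_at_leftE//.
apply: limr_ge.
  rewrite -(cvg_at_leftE (fun h => h^-1 *: ((f \o shift c) _ - f c))) //.
  apply: cvg_trans df; apply: cvg_app.
  move=> A [e egt0 Ae]; exists e => // x xe xgt0; apply: Ae => //.
  exact/ltr0_neq0.
near=> h.
have h0 : h < 0 by near: h; exists 1 => /=.
have hc : 0 <= h + c.
  near: h; exists c => // r; rewrite /= distrC subr0 => /ltr_normlP[+ _] _.
  by lra.
have -> : h^-1 *: ((f \o shift c) h%:A - f c) = (f (h + c) - f c) / h.
  by rewrite /= [h%:A]mulr1 [LHS]mulrC.
rewrite ler_ndivlMr//.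
have := fa (h + c); rewrite addrK; apply.
by rewrite hc gerDr ltW.
Unshelve. all: by end_near. Qed.

(** The time derivative is bounded only at points where [z] is nonnegative and
    maximal in space: this is all that the averaging term of a nonlocal equation
    gives.  At a positive maximum over space and time of [z - eta * s], with
    [eta > 0], the derivative of [z] would be both at least [eta] and at most
    0. *)
Lemma nonlocal_max_principle (V : topologicalType) (B : set V) (T : R)
    (z : V -> R -> R) :
  compact B -> 0 <= T ->
  {within B `*` `[0, T]%classic, continuous (fun q : V * R => z q.1 q.2)} ->
  (forall x, B x -> z x 0 <= 0) ->
  (forall x s, B x -> 0 < s <= T -> derivable (z x) s 1) ->
  (forall x s, B x -> 0 < s <= T -> 0 <= z x s ->
    (forall y, B y -> z y s <= z x s) -> derive1 (z x) s <= 0) ->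
  forall x s, B x -> 0 <= s <= T -> z x s <= 0.
Proof.
move=> cB T0 cz z0 dz z_max x s Bx sT.
suff le_eta eta : 0 < eta -> z x s <= eta * s.
  have [s0|s0] := eqVneq s 0; first by rewrite s0; exact: z0.
  have {}s0 : 0 < s by rewrite lt_def s0; case/andP: sT.
  apply/ler_addgt0Pr => e e0; rewrite add0r.
  by have := le_eta (e / s) (divr_gt0 e0 s0); rewrite divfK// gt_eqF.
move=> eta0.
have cBT : compact (B `*` `[0, T]%classic).
  by apply: compact_setX => //; exact: segment_compact.
have BT0 : B `*` `[0, T]%classic !=set0.
  by exists (x, s); split => //=; rewrite in_itv.
have [|[x1 s1]] :=
    @compact_EVT_max _ R (fun q => z q.1 q.2 - eta * q.2) _ BT0 cBT.
  apply: within_continuousB => //; apply: continuous_subspaceT => q.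
  by apply: cvgM; [exact: cvg_cst|exact: cvg_snd].
rewrite inE => -[/= Bx1]; rewrite in_itv/= => s1T F_max.
have {}F_max y r :
    B y -> 0 <= r <= T -> z y r - eta * r <= z x1 s1 - eta * s1.
  move=> By rT; apply: (F_max (y, r)); rewrite inE; split => //=.
suff : z x1 s1 - eta * s1 <= 0.
  by move=> /(le_trans (F_max x s Bx sT)); rewrite subr_le0.
have [s10|s10] := eqVneq s1 0; first by rewrite s10 mulr0 subr0 z0.
have s1_gt0 : 0 < s1 by rewrite lt_def s10; case/andP: s1T.
have s1T' : 0 < s1 <= T by rewrite s1_gt0; case/andP: s1T.
rewrite leNgt; apply/negP => Fpos.
have : derive1 (z x1) s1 <= 0.
  apply: z_max => //.
    by rewrite ltW// (lt_trans _ (_ : eta * s1 < _)) ?mulr_gt0// -subr_gt0.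
  move=> y By; have := F_max y s1 By.
  by rewrite lerD2r; apply; rewrite ltW//; case/andP: s1T.
suff : eta <= derive1 (z x1) s1.
  by move=> /le_trans /[apply]; rewrite leNgt eta0.
apply: derive1_ge_left => //; first exact: dz.
move=> r rs1; have := F_max x1 r Bx1; rewrite lerBlDr mulrBr => /(_ _) h.
have /h : 0 <= r <= T by case/andP: rs1 => -> /le_trans; apply; case/andP: s1T.
lra.
Qed.

End MaximumPrinciple.

(** * Euclidean balls *)

Section EuclideanBall.
Context {R : realType} {n : nat}.
Implicit Types x y p : 'rV[R]_n.

Lemma dot_ge0 x : 0 <= dot x x.
Proof. by apply: sumr_ge0 => i _; rewrite -expr2 sqr_ge0. Qed.

Lemma enorm_ge0 x : 0 <= enorm x. Proof. exact: sqrtr_ge0. Qed.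

Lemma enorm_sqr x : enorm x ^+ 2 = dot x x.
Proof. by rewrite sqr_sqrtr// dot_ge0. Qed.

Lemma enormZ (c : R) x : enorm (c *: x) = `|c| * enorm x.
Proof.
by rewrite /enorm dotZr dotC dotZr mulrA -expr2 sqrtrM ?sqr_ge0// sqrtr_sqr.
Qed.

Lemma coord_le_enorm x i : `|x ord0 i| <= enorm x.
Proof.
rewrite -sqrtr_sqr ler_sqrt ?dot_ge0// /dot (bigD1 i)//= -expr2 lerDl.
by apply: sumr_ge0 => j _; rewrite -expr2 sqr_ge0.
Qed.

Lemma continuous_dot (T : topologicalType) (f g : T -> 'rV[R]_n) :
  continuous f -> continuous g -> continuous (fun s => dot (f s) (g s)).
Proof.
move=> cf cg; apply: continuous_big => [|i _].
  exact: add_continuous.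
have coord (h : T -> 'rV[R]_n) : continuous h ->
    continuous (fun s => h s ord0 i).
  move=> ch s.
  apply: (@continuous_comp _ _ _ h (fun x : 'rV[R]_n => x ord0 i) s (ch s)).
  exact: coord_continuous.
by move=> s; exact: (cvgM (coord f cf s) (coord g cg s)).
Qed.

Lemma continuous_enorm : continuous (@enorm R n).
Proof.
move=> x; apply: (@continuous_comp _ _ _ (fun x => dot x x) (@Num.sqrt R) x).
  by apply: continuous_dot => ?; exact: cvg_id.
exact: sqrt_continuous.
Qed.

Lemma closed_eball (r : R) : closed (@eball R n r).
Proof.
apply: (@preimage_closed _ _ _ [set x | x <= r]); last exact: closed_le.
by move=> x _; exact: continuous_enorm.
Qed.

Lemma compact_eball (r : R) : compact (@eball R n r).
Proof.
apply: bounded_closed_compact; last exact: closed_eball.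
exists r; split; first exact: num_real.
move=> M rM x /= xr; rewrite [leLHS]/Num.norm/= mx_normrE.
have r0 : 0 <= r := le_trans (enorm_ge0 x) xr.
apply: bigmax_le => [|[a i] _ /=]; first exact: ltW (le_lt_trans r0 rM).
by rewrite (ord1 a) (le_trans (coord_le_enorm x i))// (le_trans xr)// ltW.
Qed.

Lemma measurable_eball (r : R) : measurable (@eball R n r).
Proof.
rewrite -[eball r]setCK; apply: measurableC; apply: open_rV_measurable.
exact/closed_openC/closed_eball.
Qed.

End EuclideanBall.

(** * Averages against a shifted kernel *)

Section KernelMean.
Context {R : realType} {n : nat}.
Local Notation V := 'rV[R]_n.
Local Notation mu := (lebesgue_rV n).
Variable K : V -> R.
Hypothesis hK : borel_kernel K.

Lemma measurable_kernel_shift (x : V) :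
  measurable_fun setT (fun y : V => K (x - y)).
Proof.
have [mK _ _ _ _] := hK.
have := measurableT_comp mK (measurable_reflect [set: 'I_n]%SET x).
by congr measurable_fun; apply/funext => y; rewrite /= reflect_setT.
Qed.

Lemma integral_kernel_shift (x : V) : (\int[mu]_y (K (x - y))%:E = 1)%E.
Proof.
have [mK K0 K1 _ _] := hK.
have mEK : measurable_fun setT (fun y => (K y)%:E) by exact/measurable_EFinP.
have EK0 y : (0 <= (K y)%:E)%E by rewrite lee_fin.
have := @ge0_integral_reflect R n [set: 'I_n]%SET x _ mEK EK0.
by under eq_integral do rewrite reflect_setT; rewrite K1.
Qed.

Lemma integrable_kernel_shift (x : V) :
  mu.-integrable setT (EFin \o (fun y : V => K (x - y))).
Proof.
have [mK K0 K1 _ _] := hK; apply/integrableP; split.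
  by apply/measurable_EFinP; exact: measurable_kernel_shift.
under eq_integral do rewrite /= ger0_norm//.
by rewrite integral_kernel_shift ltry.
Qed.

Lemma integrable_kernel_bounded (x : V) (g : V -> R) (M : R) :
  measurable_fun setT g -> (forall y, `|g y| <= M) ->
  mu.-integrable setT (EFin \o (fun y => K (x - y) * g y)).
Proof.
have [mK K0 K1 _ _] := hK => mg gM.
have := integrableZl measurableT M (integrable_kernel_shift x).
apply: le_integrable => //.
  apply/measurable_EFinP/measurable_funM => //; exact: measurable_kernel_shift.
move=> y _ /=; rewrite lee_fin !normrM mulrC ler_wpM2r//.
exact: le_trans (gM y) (ler_norm M).
Qed.

Lemma integrable_kernel_exp (x p : V) (b : R) :
  mu.-integrable setT (EFin \o (fun y => K (x - y) * expR (dot p y + b))).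
Proof.
have [mK K0 K1 sK eK] := hK; apply/integrableP; split.
  apply/measurable_EFinP/measurable_funM => //.
    exact: measurable_kernel_shift.
  apply: measurableT_comp => //; apply: measurable_funD => //.
  exact: measurable_dot.
under eq_integral do
  rewrite /= ger0_norm ?mulr_ge0 ?expR_ge0// expRD mulrA mulrC EFinM.
have mKe : measurable_fun setT (fun y : V => (K (x - y) * expR (dot p y))%:E).
  apply/measurable_EFinP/measurable_funM; first exact: measurable_kernel_shift.
  exact: measurable_expR_dot.
have Ke0 y : (0 <= (K (x - y) * expR (dot p y))%:E)%E.
  by rewrite lee_fin mulr_ge0 ?expR_ge0.
rewrite ge0_integralZl ?lee_fin ?expR_ge0//.
by rewrite (mgf_convolution hK) -EFinM ltry.
Qed.

Lemma kernel_mean_exp (x p : V) (b : R) :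
  \int[mu]_y (K (x - y) * expR (dot p y + b)) = mgf K p * expR (dot p x + b).
Proof.
have [mK K0 K1 sK eK] := hK; rewrite /Rintegral.
under eq_integral do rewrite expRD mulrA mulrC EFinM.
have mKe : measurable_fun setT (fun y : V => (K (x - y) * expR (dot p y))%:E).
  apply/measurable_EFinP/measurable_funM; first exact: measurable_kernel_shift.
  exact: measurable_expR_dot.
have Ke0 y : (0 <= (K (x - y) * expR (dot p y))%:E)%E.
  by rewrite lee_fin mulr_ge0 ?expR_ge0.
rewrite ge0_integralZl ?lee_fin ?expR_ge0//.
by rewrite (mgf_convolution hK) -EFinM /= expRD; ring.
Qed.

Lemma kernel_mean_sum (x : V) (I : Type) (s : seq I) (f : I -> V -> R) :
  (forall i, mu.-integrable setT (EFin \o (fun y => K (x - y) * f i y))) ->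
  mu.-integrable setT (EFin \o (fun y => K (x - y) * \sum_(i <- s) f i y)) /\
  \int[mu]_y (K (x - y) * \sum_(i <- s) f i y) =
    \sum_(i <- s) \int[mu]_y (K (x - y) * f i y).
Proof.
move=> intf; elim: s => [|i s [ints IH]].
  rewrite (_ : (fun y => _) = cst 0); last first.
    by apply/funext => y; rewrite big_nil mulr0.
  by rewrite big_nil; split; [exact: integrable0|rewrite /Rintegral integral0].
rewrite (_ : (fun y => _) =
    (fun y => K (x - y) * f i y + K (x - y) * \sum_(j <- s) f j y)); last first.
  by apply/funext => y; rewrite big_cons mulrDr.
rewrite big_cons RintegralD// IH; split => //.
exact: (integrableD measurableT (intf i) ints).
Qed.

End KernelMean.

(** * Comparison with exponential barriers *)

Lemma continuous_pair_cst (T U : topologicalType) (s : U) :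
  continuous (fun y : T => (y, s)).
Proof.
move=> y; exact: (@cvg_pair _ _ _ (nbhs y) (nbhs y) (nbhs s) _ _ _ id (cst s)
  cvg_id (cvg_cst s)).
Qed.

Section Comparison.
Context {R : realType} {n : nat}.
Local Notation V := 'rV[R]_n.
Local Notation mu := (lebesgue_rV n).

Lemma is_derive_exp_affine (a h s : R) :
  is_derive s 1 (fun s : R => expR (a + h * s)) (h * expR (a + h * s)).
Proof.
have aff : is_derive s 1 (fun s : R => a + h * s) h.
  have := is_deriveD (is_derive_cst a s 1) (is_deriveZ h (is_derive_id s 1)).
  by rewrite add0r [h%:A]mulr1.
rewrite mulrC.
exact: (@is_derive1_comp R expR (fun s => a + h * s) s _ _
  (is_derive_expR _) aff).
Qed.

Lemma is_derive_bigsum (I : Type) (r : seq I) (f : I -> R -> R)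
    (df : I -> R) (s : R) :
  (forall i, is_derive s 1 (f i) (df i)) ->
  is_derive s 1 (fun s => \sum_(i <- r) f i s) (\sum_(i <- r) df i).
Proof.
move=> hf; elim: r => [|i r IH].
  rewrite big_nil (_ : (fun s => _) = cst 0); first exact: is_derive_cst.
  by apply/funext => t; rewrite big_nil.
rewrite big_cons (_ : (fun s => _) = f i \+ (fun s => \sum_(j <- r) f j s)).
  exact: is_deriveD.
by apply/funext => t; rewrite big_cons.
Qed.

Variables (I : finType) (p : I -> V) (b h : I -> R).

(** For [h i = mgf K (p i) - 1] each summand solves the equation in the whole
    space. *)
Definition barrier (x : V) (s : R) : R :=
  \sum_i expR (dot (p i) x - b i + h i * s).

Lemma barrier_ge0 x s : 0 <= barrier x s.
Proof. by apply: sumr_ge0 => i _; exact: expR_ge0. Qed.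

Lemma continuous_barrier : continuous (fun q : V * R => barrier q.1 q.2).
Proof.
apply: continuous_big => [|i _ q]; first exact: add_continuous.
apply: (@continuous_comp _ _ _
  (fun q : V * R => dot (p i) q.1 - b i + h i * q.2) (@expR R) q);
  last exact: continuous_expR.
apply: cvgD.
  apply: cvgB; last exact: cvg_cst.
  by apply: (@continuous_dot R n _ (cst (p i)) fst) => q';
    [exact: cvg_cst|exact: cvg_fst].
by apply: cvgM; [exact: cvg_cst|exact: cvg_snd].
Qed.

Lemma is_derive_barrier (x : V) (s : R) :
  is_derive s 1 (barrier x)
    (\sum_i h i * expR (dot (p i) x - b i + h i * s)).
Proof. by apply: is_derive_bigsum => i; exact: is_derive_exp_affine. Qed.

Variable K : V -> R.
Hypothesis hK : borel_kernel K.

Lemma kernel_mean_barrier (x : V) (s : R) :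
  mu.-integrable setT (EFin \o (fun y => K (x - y) * barrier y s)) /\
  \int[mu]_y (K (x - y) * barrier y s) =
    \sum_i mgf K (p i) * expR (dot (p i) x - b i + h i * s).
Proof.
have [|intb ->] := @kernel_mean_sum R n K x I (index_enum I)
    (fun i y => expR (dot (p i) y - b i + h i * s)).
  by move=> i; under eq_fun do rewrite -addrA; exact: integrable_kernel_exp.
split => //; apply: eq_bigr => i _.
by under eq_Rintegral do rewrite -addrA; rewrite kernel_mean_exp// -addrA.
Qed.

Lemma kernel_mean_le (x : V) (g : V -> R) (c : R) :
  mu.-integrable setT (EFin \o (fun y => K (x - y) * g y)) ->
  (forall y, g y <= c) -> \int[mu]_y (K (x - y) * g y) <= c.
Proof.
have [_ K0 _ _ _] := hK => intg gc.
have intc : mu.-integrable setT (EFin \o (fun y => c * K (x - y))).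
  exact: (integrableZl measurableT c (integrable_kernel_shift hK x)).
apply: (@le_trans _ _ (\int[mu]_y (c * K (x - y)))).
  apply: le_Rintegral => // y _.
  by rewrite mulrC ler_wpM2r.
rewrite RintegralZl//; last exact: integrable_kernel_shift.
by rewrite /Rintegral integral_kernel_shift// mulr1.
Qed.

(** The function [z = sg * (u - v) - M * barrier] satisfies the equation of the
    whole space inside the ball, because [v] vanishes outside it, and is
    nonpositive outside the ball and at time 0. *)
Lemma dirichlet_error (J u0 : V -> R) (u v : V -> R -> R) (r M : R) :
  (forall x (g : V -> R),
    \int[mu]_y (J (x - y) * g y) = \int[mu]_y (K (x - y) * g y)) ->
  (forall i, h i = mgf K (p i) - 1) -> (forall i, 0 <= h i) ->
  bounded_strong_solution J u0 u -> dirichlet_solution J u0 r v ->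
  (forall x t, 0 <= t -> `|u x t| <= M) ->
  (forall y, ~ eball r y -> exists i, b i <= dot (p i) y) ->
  forall x t, eball r x -> 0 <= t -> `|u x t - v x t| <= M * barrier x t.
Proof.
move=> JK hE h0 [_ cu du _ [eu u0E]] [[Mv vM] cv ev v0E v_out] uM cover.
have M0 : 0 <= M by exact: le_trans (normr_ge0 _) (uM 0 0 (lexx _)).
have mu_ (s : R) : 0 <= s -> measurable_fun setT (fun y => u y s).
  move=> s0; apply: within_continuous_measurable => //.
  apply: (@within_continuous_comp _ _ _ setT _ (fun y : V => (y, s))
    _ _ _ cu) => //.
  exact: continuous_pair_cst.
have mv_ (s : R) : 0 <= s -> measurable_fun setT (fun y => v y s).
  move=> s0; rewrite (_ : (fun y => v y s) = (fun y => v y s) \_ (eball r)).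
    apply: (measurable_restrictT _ (measurable_eball r)).1.
    apply: (within_continuous_measurable (measurable_eball r)).
    apply: (@within_continuous_comp _ _ _ (eball r) _ (fun y : V => (y, s))
      _ _ _ cv) => //.
    exact: continuous_pair_cst.
  apply/funext => y; rewrite patchE; case: ifPn => // /negP; rewrite inE => yr.
  exact: v_out.
have barrier_ge1 (y : V) (s : R) : 0 <= s -> ~ eball r y -> 1 <= barrier y s.
  move=> s0 /cover[i bi]; rewrite /barrier (bigD1 i)//= ler_wpDr//.
    by apply: sumr_ge0 => j _; exact: expR_ge0.
  by rewrite -[leLHS]expR0 ler_expR addr_ge0 ?subr_ge0// mulr_ge0.
(* The lower and the upper bound are the same statement for [sg = -1] and
   [sg = 1]. *)
suff one_side (sg : R) : `|sg| = 1 ->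
    forall (x : V) (t : R), eball r x -> 0 <= t ->
    sg * (u x t - v x t) - M * barrier x t <= 0.
  move=> x t xr t0; rewrite ler_norml.
  have := one_side 1 (normr1 _) x t xr t0.
  have := one_side (- 1) _ x t xr t0; rewrite normrN1 => /(_ erefl).
  by rewrite mulN1r mul1r; lra.
move=> sg1 x t xr t0.
pose z y s := sg * (u y s - v y s) - M * barrier y s.
have z_out (y : V) (s : R) : 0 <= s -> ~ eball r y -> z y s <= 0.
  move=> s0 yr; rewrite /z v_out// subr0 subr_le0.
  apply: (@le_trans _ _ M).
    by rewrite (le_trans (ler_norm _))// normrM sg1 mul1r uM.
  by rewrite ler_peMr// barrier_ge1.
have dz (y : V) (s : R) : eball r y -> 0 < s -> is_derive s 1 (z y)
    (sg * (derive1 (u y) s - derive1 (v y) s) -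
     M * \sum_i h i * expR (dot (p i) y - b i + h i * s)).
  move=> yr s0; have [dv _] := ev y s yr s0.
  have du' : is_derive s 1 (u y) (derive1 (u y) s).
    by rewrite derive1E; exact/derivableP/du.
  have dv' : is_derive s 1 (v y) (derive1 (v y) s).
    by rewrite derive1E; exact/derivableP.
  exact: (is_deriveB (is_deriveZ sg (is_deriveB du' dv'))
    (is_deriveZ M (is_derive_barrier y s))).
have z_mean (y : V) (s : R) : 0 <= s ->
    mu.-integrable setT (EFin \o (fun w => K (y - w) * z w s)) /\
    \int[mu]_w (K (y - w) * z w s) =
      sg * (\int[mu]_w (K (y - w) * u w s) - \int[mu]_w (K (y - w) * v w s))
      - M * \sum_i mgf K (p i) * expR (dot (p i) y - b i + h i * s).
  move=> s0; have [intb <-] := kernel_mean_barrier y s.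
  have intu := integrable_kernel_bounded hK y (mu_ s s0) (fun w => uM w s s0).
  have intv := integrable_kernel_bounded hK y (mv_ s s0) (fun w => vM w s s0).
  have intuv := integrableB measurableT intu intv.
  have intsg := integrableZl measurableT sg intuv.
  have intM := integrableZl measurableT M intb.
  rewrite (_ : (fun w => K (y - w) * z w s) =
      (fun w => sg * (K (y - w) * u w s - K (y - w) * v w s)
        - M * (K (y - w) * barrier w s))); last first.
    by apply/funext => w; rewrite /z; ring.
  split; first exact: (integrableB measurableT intsg intM).
  rewrite RintegralB//; congr (_ - _); last by rewrite RintegralZl.
  by rewrite RintegralZl// RintegralB.
apply: (@nonlocal_max_principle R V (eball r) t z) => //; last first.
- by rewrite t0 lexx.
- move=> y s yr /andP[s0 _] z0 zmax.
  have [intz meanz] := z_mean y s (ltW s0).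
  have int_ball : \int[mu]_(w in eball r) (J (y - w) * v w s) =
      \int[mu]_w (J (y - w) * v w s).
    rewrite Rintegral_mkcond; apply: eq_Rintegral => w _.
    rewrite patchE; case: ifPn => // /negP; rewrite inE => wr.
    by rewrite v_out ?mulr0// ltW.
  have -> : derive1 (z y) s = \int[mu]_w (K (y - w) * z w s) - z y s.
    have dzy := dz y s yr s0; rewrite derive1E (derive_val (is_derive := dzy)).
    rewrite eu//; have [_ ->] := ev y s yr s0; rewrite meanz.
    rewrite int_ball !JK.
    have -> : \sum_i h i * expR (dot (p i) y - b i + h i * s) =
        \sum_i mgf K (p i) * expR (dot (p i) y - b i + h i * s) - barrier y s.
      by rewrite -sumrB; apply: eq_bigr => i _; rewrite {1}hE mulrBl mul1r.
    by rewrite /z; ring.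
  rewrite subr_le0; apply: kernel_mean_le => // w.
  have [/zmax//|wr] := pselect (eball r w).
  by apply: le_trans z0; apply: z_out => //; exact: ltW.
- move=> y s yr /andP[s0 _]; have dzy := dz y s yr s0.
  exact: (ex_derive (is_derive := dzy)).
- move=> y yr; rewrite /z u0E v0E// subrr mulr0 sub0r oppr_le0.
  by rewrite mulr_ge0// barrier_ge0.
- have within_u : {within eball r `*` `[0, t]%classic,
      continuous (fun q : V * R => u q.1 q.2)}.
    apply: (continuous_subspaceW _ cu) => -[y s] [/= _].
    by rewrite in_itv/= => /andP[].
  have within_v : {within eball r `*` `[0, t]%classic,
      continuous (fun q : V * R => v q.1 q.2)}.
    apply: (continuous_subspaceW _ cv) => -[y s] [/= yr].
    by rewrite in_itv/= => /andP[].
  apply: within_continuousB.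
    move=> q; apply: cvgM; first exact: cvg_cst.
    exact: (within_continuousB within_u within_v).
  apply: continuous_subspaceT => q; apply: cvgM; first exact: cvg_cst.
  exact: continuous_barrier.
- exact: compact_eball.
Qed.

End Comparison.

(** * Cells of directions *)

Section Directions.
Context {R : realType} {n : nat}.
Implicit Types w p : 'rV[R]_n.

Lemma coord_le_norm p i : `|p ord0 i| <= `|p|.
Proof.
rewrite [leRHS]/Num.norm/= mx_normrE.
exact: (le_bigmax _ (fun ij => `|p ij.1 ij.2|) (ord0, i)).
Qed.

Lemma normr_dot_le p w (e : R) :
  (forall i, `|w ord0 i| <= e) -> `|dot p w| <= n%:R * `|p| * e.
Proof.
move=> we; apply: (le_trans (ler_norm_sum _ _ _)).
apply: (@le_trans _ _ (\sum_(i < n) `|p| * e)).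
  by apply: ler_sum => i _; rewrite normrM ler_pM// coord_le_norm.
by rewrite sumr_const card_ord -[leLHS]mulr_natl mulrA.
Qed.

(** The grid cell of side [1 / k] that contains [w], recorded by the integer
    parts of [k * (w_i + 1)]; for a unit vector these are at most [2 * k]. *)
Definition cell (k : nat) w : {ffun 'I_n -> 'I_(2 * k).+1} :=
  [ffun i => inord (Num.truncn (k%:R * (w ord0 i + 1)))].

Lemma card_cell (k : nat) :
  #|{ffun 'I_n -> 'I_(2 * k).+1}| = ((2 * k).+1 ^ n)%N.
Proof. by rewrite card_ffun !card_ord. Qed.

Lemma cell_close (k : nat) w w' : (0 < k)%N -> enorm w = 1 -> enorm w' = 1 ->
  cell k w = cell k w' -> forall i, `|(w - w') ord0 i| <= k%:R^-1.
Proof.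
move=> k0 w1 w1' ww' i.
have k0' : 0 < k%:R :> R by rewrite ltr0n.
have bound (z : 'rV[R]_n) :
    enorm z = 1 -> 0 <= k%:R * (z ord0 i + 1) <= (2 * k)%:R.
  move=> z1; have := coord_le_enorm z i; rewrite z1 ler_norml => /andP[h1 h2].
  apply/andP; split; first by rewrite mulr_ge0 ?(ltW k0')//; lra.
  by rewrite mulrC natrM ler_wpM2r ?(ltW k0')//; lra.
have trunc_lt (z : 'rV[R]_n) : enorm z = 1 ->
    (Num.truncn (k%:R * (z ord0 i + 1)) < (2 * k).+1)%N.
  move=> /bound /andP[z0 zk]; rewrite ltnS truncn_le_nat.
  by rewrite (le_lt_trans zk)// ltr_nat.
move: ww' => /ffunP/(_ i); rewrite !ffunE => /(congr1 val).
rewrite /= !inordK ?trunc_lt// => eq_trunc.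
have /andP[a1 a2] := truncn_itv (proj1 (andP (bound w w1))).
have /andP[b1 b2] := truncn_itv (proj1 (andP (bound w' w1'))).
rewrite eq_trunc in a1 a2.
rewrite !mxE -[leRHS]mul1r ler_pdivlMr// -[X in _ * X](gtr0_norm k0') -normrM.
move: b1 b2 a1 a2; rewrite -natr1; set N := _%:R; move=> b1 b2 a1 a2.
rewrite ler_norml; apply/andP; split; lra.
Qed.

End Directions.

(** * Momenta for the exit directions *)

Section LagrangianDirections.
Context {R : realType} {n : nat}.
Local Notation V := 'rV[R]_n.
Variables (J : V -> R) (h : V -> R) (c : R).
Hypothesis hamE : forall p, hamiltonian J p = (h p)%:E.
Hypothesis h0 : h 0 = 0.
Hypothesis c0 : 0 < c.
Hypothesis h_quad : forall (p : V) i, c * (p ord0 i) ^+ 2 <= h p.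
Hypothesis h_ge0 : forall p, 0 <= h p.

(** If the profile is the common value of the Lagrangian on the sphere of radius
    [r], a nearly optimal momentum exists in each direction.  It can be replaced
    by 0 when [dot p w < 0], since [h >= 0].  If there is no common value, the
    profile is 0 and the momentum 0 serves. *)
Lemma Lstar_momentum (r a : R) (w : V) : 0 <= r -> 0 < a -> enorm w = 1 ->
  0 <= Lstar J r /\
  exists p, 0 <= dot p w /\ Lstar J r - a <= r * dot p w - h p.
Proof.
move=> r0 a0 w1.
rewrite /Lstar; case: xgetP => [s _ /= Ls|_]; last first.
  by split => //; exists 0; rewrite dot0l h0 mulr0; split => //; lra.
have Lrw : lagrangian J (r *: w) = s%:E.
  by apply: Ls; rewrite enormZ w1 mulr1 ger0_norm.
have s0 : 0 <= s.
  rewrite -lee_fin -Lrw; apply: ereal_sup_ubound; exists 0 => //.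
  by rewrite hamE h0 dot0l sube0.
split => //.
have : ((s - a)%:E < lagrangian J (r *: w))%E by rewrite Lrw lte_fin; lra.
move=> /ereal_sup_gt[_ [p _ <-]]; rewrite hamE -EFinB lte_fin dotZr => sp.
have [pw|pw] := leP 0 (dot p w); first by exists p; split => //; exact: ltW.
exists 0; rewrite dot0l h0 mulr0; split => //.
have : r * dot p w <= 0 by rewrite mulr_ge0_le0// ltW.
by have := h_ge0 p; lra.
Qed.

(** The quadratic growth of [h] against the linear term [r * dot p w]. *)
Lemma momentum_bound (r a s : R) (p w : V) : 0 <= r -> 0 <= a -> 0 <= s ->
  enorm w = 1 -> s - a <= r * dot p w - h p ->
  `|p| <= 1 + (r * n%:R + a) / c.
Proof.
move=> r0 a0 s0 w1 sp.
have P0 : 0 <= (r * n%:R + a) / c by rewrite divr_ge0 ?addr_ge0 ?mulr_ge0// ltW.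
have [p1|p1] := leP `|p| 1; first by rewrite (le_trans p1)// lerDl.
have [j pj] : exists j, `|p| = `|p ord0 j|.
  have /mx_norm_neq0[[i j] /= ij] : mx_norm p != 0.
    by rewrite gt_eqF// (lt_trans ltr01).
  by exists j; rewrite (ord1 i) in ij.
have pw : dot p w <= n%:R * `|p|.
  rewrite -[leRHS]mulr1 (le_trans (ler_norm _))// normr_dot_le// => i.
  by rewrite -w1 coord_le_enorm.
have : c * `|p| ^+ 2 <= r * n%:R * `|p| + a * `|p|.
  apply: (@le_trans _ _ (h p)).
    by rewrite pj -normrX ger0_norm ?sqr_ge0.
  have : r * dot p w <= r * n%:R * `|p| by rewrite -mulrA ler_wpM2l.
  have : a <= a * `|p| by rewrite ler_peMr// ltW.
  lra.
rewrite -mulrDl expr2 mulrA ler_pM2r ?(lt_trans ltr01)//.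
rewrite mulrC -ler_pdivlMr// => pP.
by rewrite (le_trans pP)// lerDr.
Qed.

(** One momentum per cell of directions.  Replacing the direction [w] of [y - x]
    by the representative [w'] of its cell changes [dot p w] by at most
    [n * |p| / k].  As [y] may be far away, this loss must not be multiplied by
    [enorm (y - x)]: the lower bound for [dot p w] is nonnegative unless
    [t * s <= 1 + loss], and in that case the momentum 0 serves everywhere. *)
Lemma exit_cover (x : V) (A : set V) (l t : R) (k : nat) :
  0 <= l -> 0 < t -> (0 < k)%N -> ~ A x ->
  (forall y, A y -> l <= enorm (y - x)) ->
  let s := Lstar J (l / t) in
  let loss := l * n%:R * (1 + (l / t * n%:R + t^-1) / c) / k%:R in
  exists p : {ffun 'I_n -> 'I_(2 * k).+1} -> V, forall y, A y ->
    exists i, t * s - 1 - loss + t * h (p i) <= dot (p i) (y - x).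
Proof.
move=> l0 t0 k0 nAx lA s loss.
have r0 : 0 <= l / t by rewrite divr_ge0// ltW.
have a0 : 0 < t^-1 by rewrite invr_gt0.
have k0' : 0 < k%:R :> R by rewrite ltr0n.
pose P := 1 + (l / t * n%:R + t^-1) / c.
have [small|big] := leP (t * s) (1 + loss).
  exists (fun=> 0) => y _; exists [ffun=> ord0].
  by rewrite h0 dot0l; lra.
pose good i p := exists w, [/\ enorm w = 1, cell k w = i, 0 <= dot p w &
  s - t^-1 <= l / t * dot p w - h p].
exists (fun i => xget 0 [set p | good i p]) => y Ay.
have D0 : 0 < enorm (y - x).
  rewrite lt_def enorm_ge0 andbT; apply/eqP => D0; apply: nAx.
  suff -> : x = y by [].
  apply/rowP => i; apply/eqP; rewrite eq_sym -subr_eq0 -normr_le0.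
  by have := coord_le_enorm (y - x) i; rewrite D0 !mxE.
pose w := (enorm (y - x))^-1 *: (y - x).
have w1 : enorm w = 1 by rewrite enormZ gtr0_norm ?invr_gt0// mulVf// gt_eqF.
have yw : y - x = enorm (y - x) *: w by rewrite scalerA divff ?scale1r// gt_eqF.
have [s0 [p0 [p0w p0s]]] := Lstar_momentum r0 a0 w1.
have H : good (cell k w) (xget 0 [set p | good (cell k w) p]).
  by apply: (@xgetI _ 0 _ p0); exists w.
exists (cell k w); move: (xget _ _) H => p [w' [w1' ww' pw' sp]].
have pP := momentum_bound r0 (ltW a0) s0 w1' sp.
have close : dot p w' - n%:R * P / k%:R <= dot p w.
  have /normr_dot_le : forall i, `|(w - w') ord0 i| <= k%:R^-1.
    exact: cell_close k0 w1 w1' (esym ww').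
  move=> /(_ p); rewrite dotBr ler_norml => /andP[+ _].
  have : n%:R * `|p| / k%:R <= n%:R * P / k%:R.
    by rewrite ler_wpM2r ?invr_ge0 ?(ltW k0')// ler_wpM2l.
  lra.
have sp' : t * s - 1 <= l * dot p w' - t * h p.
  have : t * (s - t^-1) <= t * (l / t * dot p w' - h p) by rewrite ler_pM2l.
  rewrite !mulrBr divff ?gt_eqF// (_ : t * (l / t * dot p w') = l * dot p w')//.
  by field; rewrite gt_eqF.
have lossE : loss = l * (n%:R * P / k%:R) by rewrite /loss -/P; ring.
have gap : 0 <= dot p w' - n%:R * P / k%:R.
  rewrite leNgt; apply/negP => neg.
  have : l * dot p w' <= loss by rewrite lossE ler_wpM2l//; lra.
  have : 0 <= t * h p by rewrite mulr_ge0// ltW.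
  lra.
have : l * (dot p w' - n%:R * P / k%:R) <= enorm (y - x) * dot p w.
  by rewrite ler_pM// lA.
rewrite mulrBr -lossE -dotZr -yw.
lra.
Qed.

End LagrangianDirections.

(** * The distance to the unit sphere *)

Section BoundaryDistance.
Context {R : realType} {n : nat}.
Local Notation V := 'rV[R]_n.
Local Notation sphere_dist x := (Defs.edist x (boundary (@eball R n 1))).

Lemma unit_sphere_boundary (z : V) : enorm z = 1 -> boundary (eball 1) z.
Proof.
move=> z1; split.
  by apply: subset_closure; rewrite /eball/= z1.
rewrite /interior => zint.
have cont : (fun a : R => a *: z) a @[a --> (1 : R)] --> z.
  rewrite -[X in _ --> X]scale1r.
  by apply: cvgZ; [exact: cvg_id|exact: cvg_cst].
have /nbhs_ballP[e /= e0 he] := cont _ zint.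
have : ball (1 : R) e (1 + e / 2).
  by rewrite /ball/= opprD addrA subrr sub0r normrN gtr0_norm; lra.
move=> /he; rewrite /eball/= enormZ z1 mulr1 gtr0_norm; lra.
Qed.

Lemma edist_ge0 (x : V) (A : set V) : A !=set0 -> 0 <= Defs.edist x A.
Proof.
move=> [z Az]; apply: lb_le_inf; first by exists (enorm (x - z)), z.
by move=> _ [z' _ <-]; exact: enorm_ge0.
Qed.

Lemma edist_le (x z : V) (A : set V) : A z -> Defs.edist x A <= enorm (x - z).
Proof.
move=> Az; apply: ge_inf; last by exists z.
by exists 0 => _ [z' _ <-]; exact: enorm_ge0.
Qed.

(** The segment from [x] to [y] crosses the unit sphere. *)
Lemma sphere_dist_exit (x y : V) : enorm x <= 1 -> 1 < enorm y ->
  sphere_dist x <= enorm (y - x).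
Proof.
move=> x1 y1; pose g a := enorm (x + a *: (y - x)).
have cg : continuous g.
  move=> a; apply: (@continuous_comp _ _ _ (fun a : R => x + a *: (y - x))
    (@enorm R n) a); last exact: continuous_enorm.
  by apply: cvgD; [exact: cvg_cst|apply: cvgZ; [exact: cvg_id|exact: cvg_cst]].
have [|a] := @IVT R g 0 1 1 ler01 (continuous_subspaceT cg).
  rewrite /g scale0r addr0 scale1r [x + _]addrC subrK.
  by rewrite ge_min x1 /= le_max (ltW y1) orbT.
rewrite in_itv/= => /andP[a0 a1] ga.
apply: (le_trans (edist_le x (unit_sphere_boundary ga))).
rewrite opprD addrA subrr sub0r -scaleNr enormZ normrN ger0_norm//.
by rewrite ler_piMl// enorm_ge0.
Qed.

Lemma unit_vector : (0 < n)%N -> exists z : V, enorm z = 1.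
Proof.
move=> n0; exists (delta_mx ord0 (Ordinal n0)).
rewrite /enorm /dot (bigD1 (Ordinal n0))//= !mxE !eqxx mulr1.
rewrite big1 ?addr0 ?sqrtr1//.
by move=> i /negbTE i0; rewrite mxE i0 andbF mul0r.
Qed.

Lemma sphere_dist_bounds (x : V) : (0 < n)%N -> enorm x <= 1 ->
  0 <= sphere_dist x <= 2.
Proof.
move=> n0 x1; have [z z1] := unit_vector n0.
apply/andP; split.
  by apply: edist_ge0; exists z; exact: unit_sphere_boundary.
apply: (le_trans (edist_le x (unit_sphere_boundary z1))).
rewrite -(ler_pXn2r (_ : 0 < 2)%N) ?nnegrE ?enorm_ge0// enorm_sqr.
apply: (@le_trans _ _ (2 * dot x x + 2 * dot z z)).
  rewrite /dot !mulr_sumr -big_split/=; apply: ler_sum => i _; rewrite !mxE.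
  have := sqr_ge0 (x ord0 i + z ord0 i); rewrite !expr2; lra.
rewrite -!enorm_sqr z1 expr1n.
have : enorm x ^+ 2 <= 1 by rewrite expr_le1// enorm_ge0.
lra.
Qed.

End BoundaryDistance.

(** * Growth of the exponential *)

Section Asymptotics.
Context {R : realType}.

Lemma expR_ge_pow (a : R) (m : nat) : 0 <= a -> (0 < m)%N ->
  (a / m%:R) ^+ m <= expR a.
Proof.
move=> a0 m0; have m0' : 0 < m%:R :> R by rewrite ltr0n.
have -> : expR a = expR (a / m%:R) ^+ m.
  by rewrite -expRM_natl mulrC divfK// gt_eqF.
rewrite lerXn2r ?nnegrE ?expR_ge0 ?divr_ge0 ?ler0n//.
by rewrite (le_trans _ (expR_ge1Dx _))// lerDr.
Qed.

Lemma invr_sqrt_cvg0 : (Num.sqrt r)^-1 @[r --> +oo] --> (0 : R).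
Proof.
apply/cvgr0Pnorm_lt => e e0; near=> r.
have er : e ^- 2 < r by near: r; apply: nbhs_pinfty_gt; rewrite num_real.
have r0 : 0 < r by apply: lt_trans er; rewrite invr_gt0 exprn_gt0.
rewrite ger0_norm ?invr_ge0 ?sqrtr_ge0// invf_plt ?posrE ?sqrtr_gt0//.
by rewrite -[ltLHS]ger0_norm ?invr_ge0 ?(ltW e0)// -sqrtr_sqr ltr_sqrt// exprVn.
Unshelve. all: by end_near. Qed.

Lemma near_pow_le_expR_sqrt (C : R) (d : nat) :
  \forall r \near +oo, C * r ^+ (2 * d) <= expR (Num.sqrt r).
Proof.
(* With [a = Num.sqrt r], the bound [(a / m) ^ m] is [a / m ^ m] times
   [r ^ (2 * d)]. *)
pose m := (4 * d).+1.
near=> r.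
have r1 : 1 <= r by near: r; apply: nbhs_pinfty_ge; rewrite num_real.
have Cr : (C * m%:R ^+ m) ^+ 2 <= r.
  by near: r; apply: nbhs_pinfty_ge; rewrite num_real.
have r0 : 0 <= r by lra.
apply: le_trans (expR_ge_pow (sqrtr_ge0 r) (ltn0Sn (4 * d))).
rewrite -/m expr_div_n ler_pdivlMr ?exprn_gt0 ?ltr0n//.
have -> : Num.sqrt r ^+ m = Num.sqrt r * r ^+ (2 * d).
  have -> : m = (2 * (2 * d)).+1 by rewrite /m mulnA.
  by rewrite exprS exprM sqr_sqrtr.
rewrite mulrAC ler_wpM2r ?exprn_ge0//.
apply: (le_trans (ler_norm _)); rewrite -sqrtr_sqr ler_sqrt//.
Unshelve. all: by end_near. Qed.

End Asymptotics.

(** * The rate of convergence *)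

Section ErrorRate.
Context {R : realType} {n : nat}.
Local Notation V := 'rV[R]_n.
Local Notation mu := (lebesgue_rV n).

Lemma mgf_quadratic_uniform (K : V -> R) : borel_kernel K ->
  exists2 c : R, 0 < c & forall (p : V) j, c * (p ord0 j) ^+ 2 <= mgf K p - 1.
Proof.
move=> hK.
have /choice[c hc] : forall j, exists c : R, 0 < c /\
    forall p : V, 1 + c * (p ord0 j) ^+ 2 <= mgf K p.
  by move=> j; have [c c0 cp] := mgf_quadratic hK j; exists c.
exists (\big[Num.min/1]_j c j).
  by apply: lt_bigmin => // j _; exact: (hc j).1.
move=> p j; have := (hc j).2 p.
have : \big[Num.min/1]_i c i * (p ord0 j) ^+ 2 <= c j * (p ord0 j) ^+ 2.
  by rewrite ler_wpM2r ?sqr_ge0// bigmin_le_cond.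
lra.
Qed.

Lemma mgf0 (K : V -> R) : borel_kernel K -> mgf K 0 = 1.
Proof.
move=> [_ _ K1 _ _]; rewrite /mgf.
by under eq_integral do rewrite dot0l expR0 mul1r; rewrite K1.
Qed.

Variables (J u0 : V -> R).
Hypothesis n_gt0 : (0 < n)%N.
Hypothesis J_ge0 : forall y, 0 <= J y.
Hypothesis J_meas : lebesgue_measurable_fun J.
Hypothesis J_radial : radially_symmetric J.
Hypothesis J_mass : (\int[mu]_y (J y)%:E = 1)%E.
Hypothesis J_exp : forall p, (hamiltonian J p < +oo)%E.

(** The offsets [b] are chosen so that every term of the barrier has the same
    value at [(x, t)]; the number of terms is the number of cells. *)
Lemma dirichlet_error_explicit : exists2 c : R, 0 < c &
  forall (u v : V -> R -> R) (r M l t : R) (k : nat) (x : V),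
  bounded_strong_solution J u0 u -> dirichlet_solution J u0 r v ->
  (forall y s, 0 <= s -> `|u y s| <= M) ->
  0 <= l -> 0 < t -> (0 < k)%N -> eball r x ->
  (forall y, ~ eball r y -> l <= enorm (y - x)) ->
  `|u x t - v x t| <= M * ((2 * k).+1 ^ n)%:R *
    expR (- (t * Lstar J (l / t)) + 1 +
      l * n%:R * (1 + (l / t * n%:R + t^-1) / c) / k%:R).
Proof.
have [K [hK hamK JK]] := borel_kernel_of J_ge0 J_meas J_radial J_mass J_exp.
have [c c0 quad] := mgf_quadratic_uniform hK.
exists c => // u v r M l t k x hu hv uM l0 t0 k0 xr lx.
pose h p := mgf K p - 1.
have h0 : h 0 = 0 by rewrite /h mgf0// subrr.
have h_ge0 p : 0 <= h p.
  apply: le_trans (quad p (Ordinal n_gt0)).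
  by rewrite mulr_ge0 ?sqr_ge0// ltW.
have [p cover] := exit_cover hamK h0 c0 quad h_ge0 l0 t0 k0
  (fun nx : ~ eball r x => nx xr) lx.
set loss := l * n%:R * _ / _ in cover *; set s := Lstar J _ in cover *.
pose b i := dot (p i) x + (t * s - 1 - loss + t * h (p i)).
have := @dirichlet_error R n _ p b (fun i => h (p i)) K hK J u0 u v r M JK.
move=> /(_ (fun=> erefl) (fun i => h_ge0 _) hu hv uM) => err.
apply: (le_trans (err _ x t xr (ltW t0))).
  move=> y /cover[i]; rewrite dotBr => hi; exists i.
  by rewrite /b addrC -lerBrDr.
rewrite -mulrA ler_wpM2l//.
  by apply: le_trans (normr_ge0 _) (uM 0 0 (lexx _)).
rewrite /barrier (eq_bigr (fun=> expR (- (t * s) + 1 + loss))).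
  by rewrite sumr_const card_cell -[leLHS]mulr_natl.
by move=> i _; congr expR; rewrite /b; ring.
Qed.

(** With [k] of order [r ^ 2] the momenta, of size at most [r * Q], cost a
    bounded amount in the exponent, and [M] times the number of cells is
    polynomial in [r]. *)
Lemma dirichlet_error_rate (tau : R) (u : V -> R -> R) (uD : R -> V -> R -> R) :
  0 < tau -> bounded_strong_solution J u0 u ->
  (forall r, 0 < r -> dirichlet_solution J u0 r (uD r)) ->
  \forall r \near +oo, forall (x : V) (t : R), enorm x <= r -> tau <= t ->
    `|u x t - uD r x t| <=
      expR (- r * rate J (r^-1 *: x) (t / r) + (Num.sqrt r)^-1 * r).
Proof.
move=> tau0 hu huD; have [[M uM] _ _ _ _] := hu.
have M0 : 0 <= M by exact: le_trans (normr_ge0 _) (uM 0 0 (lexx _)).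
have [c c0 explicit] := dirichlet_error_explicit.
pose Q := 1 + (2 * n%:R + 1) / (tau * c).
pose C := M * 12 ^+ n * expR (1 + 2 * n%:R * Q).
have C0 : 0 <= C by rewrite !mulr_ge0 ?exprn_ge0 ?expR_ge0.
near=> r => x t xr taut.
have r1 : 1 <= r by near: r; apply: nbhs_pinfty_ge; rewrite num_real.
have Cr : C * r ^+ (2 * n) <= expR (Num.sqrt r).
  by near: r; exact: near_pow_le_expR_sqrt.
have r0 : 0 < r by lra.
have t0 : 0 < t by lra.
have xr1 : enorm (r^-1 *: x) <= 1.
  by rewrite enormZ gtr0_norm ?invr_gt0// mulrC ler_pdivrMr// mul1r.
pose d := Defs.edist (r^-1 *: x) (boundary (eball 1)).
have /andP[d0 d2] : 0 <= d <= 2 by exact: sphere_dist_bounds.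
pose l := r * d.
have l0 : 0 <= l by rewrite mulr_ge0// ltW.
have lx y : ~ eball r y -> l <= enorm (y - x).
  move=> /negP; rewrite -ltNge => ry.
  have yE : y - x = r *: (r^-1 *: y - r^-1 *: x).
    by rewrite -scalerBr scalerA divff ?scale1r// gt_eqF.
  rewrite yE enormZ gtr0_norm// ler_pM2l//; apply: sphere_dist_exit => //.
  by rewrite enormZ gtr0_norm ?invr_gt0// mulrC ltr_pdivlMr// mul1r.
pose k := ((Num.truncn r).+1 ^ 2)%N.
have k0 : (0 < k)%N by rewrite expn_gt0.
have /andP[tr1 tr2] := truncn_itv (ltW r0).
have kr : r ^+ 2 <= k%:R <= 4 * r ^+ 2.
  rewrite /k natrX; apply/andP; split.
    by rewrite lerXn2r ?nnegrE ?(ltW r0) ?ler0n// ltW.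
  rewrite (_ : 4 * r ^+ 2 = (2 * r) ^+ 2); last by ring.
  by rewrite lerXn2r ?nnegrE ?mulr_ge0 ?(ltW r0) ?ler0n// -natr1; lra.
have /andP[k1 k2] := kr.
have k0' : 0 < k%:R :> R by rewrite ltr0n.
have := explicit u (uD r) r M l t k x hu (huD r r0) uM l0 t0 k0 xr lx.
have -> : - r * rate J (r^-1 *: x) (t / r) = - (t * Lstar J (l / t)).
  rewrite /rate -/d (_ : d / (t / r) = l / t); last first.
    by rewrite /l; field; rewrite !gt_eqF.
  by field; rewrite gt_eqF.
rewrite (_ : (Num.sqrt r)^-1 * r = Num.sqrt r); last first.
  rewrite -[X in _ * X](sqr_sqrtr (ltW r0)) expr2 mulrA mulVf ?mul1r//.
  by rewrite gt_eqF// sqrtr_gt0.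
move=> /le_trans; apply.
set loss := l * n%:R * _ / _; set s := t * _.
have lossQ : loss <= 2 * n%:R * Q.
  have tauV : t^-1 <= tau^-1 by rewrite lef_pV2 ?posrE.
  have tV0 : 0 <= t^-1 by rewrite invr_ge0 ltW.
  have l2r : l <= 2 * r by rewrite /l mulrC ler_wpM2r// ltW.
  have lt_le : l / t <= 2 * r * tau^-1 by rewrite ler_pM.
  have A_le : 1 + (l / t * n%:R + t^-1) / c <= r * Q.
    rewrite /Q mulrDr mulr1 lerD// ler_pdivrMr//.
    rewrite (_ : r * _ * c = 2 * r * tau^-1 * n%:R + r * tau^-1); last first.
      by field; rewrite !gt_eqF.
    rewrite lerD ?ler_wpM2r ?ler0n//.
    by rewrite (le_trans tauV)// ler_peMl// invr_ge0 ltW.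
  have Q0 : 0 <= Q.
    by rewrite addr_ge0// divr_ge0 ?addr_ge0 ?mulr_ge0 ?(ltW tau0) ?(ltW c0).
  rewrite ler_pdivrMr//.
  apply: (@le_trans _ _ (2 * n%:R * Q * r ^+ 2)); last first.
    by rewrite ler_wpM2l// !mulr_ge0.
  rewrite (_ : 2 * n%:R * Q * r ^+ 2 = 2 * r * n%:R * (r * Q)); last by ring.
  rewrite ler_pM ?mulr_ge0 ?ler_wpM2r ?ler0n//.
  by rewrite addr_ge0// divr_ge0 ?(ltW c0)// addr_ge0// !mulr_ge0.
(* [2 * k + 1 <= 3 * k <= 12 * r ^ 2]. *)
have cells : ((2 * k).+1 ^ n)%:R <= 12 ^+ n * r ^+ (2 * n) :> R.
  rewrite natrX exprM -exprMn.
  rewrite lerXn2r ?nnegrE ?mulr_ge0 ?exprn_ge0 ?(ltW r0) ?ler0n//.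
  rewrite -natr1 natrM.
  have : 1 <= r ^+ 2 by rewrite expr_ge1// ltW.
  lra.
rewrite -addrA expRD mulrCA [leRHS]expRD ler_wpM2l ?expR_ge0//.
apply: le_trans Cr; rewrite /C.
rewrite (_ : M * 12 ^+ n * _ * _ =
  M * (12 ^+ n * r ^+ (2 * n)) * expR (1 + 2 * n%:R * Q)); last by ring.
rewrite ler_pM ?mulr_ge0 ?expR_ge0 ?ler0n ?ler_wpM2l//.
by rewrite ler_expR lerD2l.
Unshelve. all: by end_near. Qed.

End ErrorRate.

(** * The estimate *)

Theorem theorem3p1 (R : realType) (N : nat) (J u0 : 'rV[R]_N -> R) :
  (1 <= N)%N ->
  (forall y, 0 <= J y) ->
  lebesgue_measurable_fun J ->
  radially_symmetric J ->
  (\int[lebesgue_rV N]_y (J y)%:E = 1)%E ->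
  (forall p, (hamiltonian J p < +oo)%E) ->
  (forall x, 0 <= u0 x) ->
  continuous u0 ->
  (exists M, forall x, `|u0 x| <= M) ->
  (forall (x : 'rV[R]_N) (t : R), 0 < t ->
    exists2 eps : R -> R, eps r @[r --> +oo] --> 0 &
    forall (u : 'rV[R]_N -> R -> R) (uD : R -> 'rV[R]_N -> R -> R),
      bounded_strong_solution J u0 u ->
      (forall r, 0 < r -> dirichlet_solution J u0 r (uD r)) ->
      \forall r \near +oo,
        `|u x t - uD r x t| <=
          expR (- r * rate J (r^-1 *: x) (t / r) + eps r * r)) /\
  (forall theta t1 t2 : R, 0 < theta < 1 -> 0 < t1 -> t1 < t2 ->
    exists2 eps : R -> R, eps r @[r --> +oo] --> 0 &
    forall (u : 'rV[R]_N -> R -> R) (uD : R -> 'rV[R]_N -> R -> R),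
      bounded_strong_solution J u0 u ->
      (forall r, 0 < r -> dirichlet_solution J u0 r (uD r)) ->
      \forall r \near +oo, forall (x : 'rV[R]_N) (t : R),
        enorm x <= theta * r -> t1 < t / r < t2 ->
        `|u x t - uD r x t| <=
          expR (- r * rate J (r^-1 *: x) (t / r) + eps r * r)).
Proof.
move=> n0 J0 mJ rJ J1 HJ _ _ _.
split=> [x t t0|theta t1 t2 /andP[_ theta1] t1_gt0 _];
  exists (fun r => (Num.sqrt r)^-1); try exact: invr_sqrt_cvg0.
- move=> u uD hu huD.
  have bound := dirichlet_error_rate n0 J0 mJ rJ J1 HJ t0 hu huD.
  near=> r.
  have xr : enorm x <= r by near: r; apply: nbhs_pinfty_ge; rewrite num_real.
  by move: xr (lexx t); apply: (near bound r).
- move=> u uD hu huD.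
  have bound := dirichlet_error_rate n0 J0 mJ rJ J1 HJ t1_gt0 hu huD.
  near=> r => x t xr /andP[t1r _].
  have r1 : 1 <= r by near: r; apply: nbhs_pinfty_ge; rewrite num_real.
  have r0 : 0 < r by lra.
  suff [xr' tr'] : enorm x <= r /\ t1 <= t.
    by move: xr' tr'; apply: (near bound r).
  split.
    by rewrite (le_trans xr)// ler_piMl ?(ltW r0)// ltW.
  move: t1r; rewrite ltr_pdivlMr// => /ltW; apply: le_trans.
  by rewrite ler_peMr// ltW.
Unshelve. all: by end_near. Qed.
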